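(* Let $\beta\ge0$, $b\in2^{F^0}$, and let $u:[0,\infty)\to\mathcal H$ be the solution to the SPDE $du=\dot u\,dt$, $d\dot u=-2\beta\dot u\,dt+\Delta_bu\,dt+dW$, $u(0)=\dot u(0)=0$. Then for all $(t,x)\in[0,\infty)\times F$ the expression $$u(t,x):=\sum_{k=1}^\infty Y^{b,\beta}_k(t)\phi^b_k(x)$$ is a well-defined real-valued centred Gaussian random variable. There exists a constant $c_6>0$ such that for all $x\in F$, $t\in[0,\infty)$ and $n\ge0$, $$\mathbb E\left[\left(\langle u(t),f^x_n\rangle_\mu-u(t,x)\right)^2\right]\le c_6e^{2(\sqrt{\beta^2+1}-\beta)t}2^{-n}.$$
   Context: Fractal setting. Let $M\ge2$, $I=\{1,\dots,M\}$, and let $F$ be a connected compact metric space with injective strict contractions $\psi_i:F\to F$ ($i\in I$), $F=\bigcup_i\psi_i(F)$. Put $\mathbb W_n=I^n$, $\mathbb W_*=\bigcup_{n\ge0}\mathbb W_n$, $\mathbb W=I^{\mathbb N}$, $\psi_w=\psi_{w_1}\circ\cdots\circ\psi_{w_n}$ and $F_w=\psi_w(F)$ for $w=w_1\cdots w_n\in\mathbb W_n$ (identity for the empty word). Let $\pi:\mathbb W\to F$ be the continuous surjection with $\{\pi(w)\}=\bigcap_n F_{w_1\cdots w_n}$. With $\sigma$ the left shift on $\mathbb W$ and $C=\pi^{-1}(\bigcup_{i\ne j}F_i\cap F_j)$, assume the post-critical set $P=\bigcup_{n\ge1}\sigma^n(C)$ is finite (so $(F,(\psi_i))$ is a p.c.f.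 self-similar set). Let $F^0=\pi(P)$, $F^n=\bigcup_{w\in\mathbb W_n}\psi_w(F^0)$. Let $(A_0,\mathbf r)$ be a regular irreducible harmonic structure: $A_0=(a_{xy})_{x,y\in F^0}$ is a real symmetric irreducible matrix with $a_{xy}\ge0$ for $x\ne y$ and zero row sums, $\mathbf r=(r_1,\dots,r_M)$ with $r_i\in(0,1)$, and, writing $\mathcal E_0(f,f)=\frac12\sum_{x,y\in F^0}a_{xy}(f(x)-f(y))^2$, $r_w=\prod_i r_{w_i}$ and $\mathcal E_n(f,f)=\sum_{w\in\mathbb W_n}r_w^{-1}\mathcal E_0(f\circ\psi_w|_{F^0},f\circ\psi_w|_{F^0})$ for $f:F^n\to\mathbb R$, one has $\mathcal E_0(f,f)=\min\{\mathcal E_1(g,g):g:F^1\to\mathbb R,\ g|_{F^0}=f\}$ for all $f:F^0\to\mathbb R$. Let $\mathcal D=\{f\in C(F):\sup_n\mathcal E_n(f|_{F^n},f|_{F^n})<\infty\}$, $\mathcal E(f,f)=\lim_n\mathcal E_n(f|_{F^n},f|_{F^n})$ (extended to a bilinear form by polarisation). The resistance metric is $R(x,y)=(\inf\{\mathcal E(f,f):f\in\mathcal D,f(x)=0,f(y)=1\})^{-1}$ for $x\ne y$, $R(x,x)=0$; it generates the topology of $F$. Let $r_{\min}=\min_ir_i$, $d_H$ the unique real with $\sum_i r_i^{d_H}=1$, and $\mu$ the Borel probability measure on $F$ with $\mu(F_w)=r_w^{d_H}$ for all $w\in\mathbb W_*$. Let $\mathcal H=L^2(F,\mu)$ with inner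 product $\langle\cdot,\cdot\rangle_\mu$. For $b\subseteq F^0$ (i.e. $b\in2^{F^0}$) let $\mathcal D_b=\{f\in\mathcal D:f|_{F^0\setminus b}=0\}$; $(\mathcal E,\mathcal D_b)$ is a Dirichlet form on $\mathcal H$ and $\Delta_b$ is its generator, the nonpositive self-adjoint operator with: $f\in\mathcal D(\Delta_b)$, $\Delta_bf=h$ iff $f\in\mathcal D_b$ and $\mathcal E(f,g)=-\langle h,g\rangle_\mu$ for all $g\in\mathcal D_b$. There is an orthonormal basis $(\phi^b_k)_{k\ge1}$ of $\mathcal H$ with $-\Delta_b\phi^b_k=\lambda^b_k\phi^b_k$, $0\le\lambda^b_1\le\lambda^b_2\le\cdots$; each $\phi^b_k\in\mathcal D_b$ is a continuous function. Noise and solution. $W$ is a cylindrical Wiener process on $\mathcal H$: $\mathbb E[\langle f,W(s)\rangle_\mu\langle W(t),g\rangle_\mu]=(s\wedge t)\langle f,g\rangle_\mu$; thus $(\langle\phi^b_k,W\rangle_\mu)_{k\ge1}$ are independent standard real Brownian motions. For $\lambda,\beta\ge0$, $V_\beta(\lambda,\cdot):[0,\infty)\to\mathbb R$ is the unique solution of $v''+2\beta v'+\lambda v=0$, $v(0)=0$, $v'(0)=1$. Put $Y^{b,\beta}_k(t)=\int_0^tV_\beta(\lambda^b_k,t-s)\langle\phi^b_k,dW(s)\rangle_\mu$. The unique global solution of the SPDE is the $\mathcal H$-valued centred Gaussian process $u(t)=\int_0^tV_\beta(-\Delta_b,t-s)\,dW(s)=\sum_{k\ge1}Y^{b,\beta}_k(t)\phi^b_k$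 (series in $L^2(\Omega;\mathcal H)$), taken in its $\mathcal H$-continuous version. Neighbourhoods. $B(x,\epsilon)$ is the closed $R$-ball. Fix a constant $c_5>0$ and, for each $x\in F$ and integer $n\ge0$, a Borel set $D^0_n(x)\subseteq F$ with $\mu(D^0_n(x))>r_{\min}^{d_H}2^{-d_Hn}$ and $x\in D^0_n(x)\subseteq B(x,c_52^{-n})$ (such sets exist). Put $f^x_n=\mu(D^0_n(x))^{-1}\mathbb 1_{D^0_n(x)}\in\mathcal H$. *)

(* Defs.v *)
From HB Require Import structures.
From mathcomp Require Import all_boot all_order all_algebra.
From mathcomp Require Import all_classical all_reals all_analysis.

Set Implicit Arguments.
Unset Strict Implicit.
Unset Printing Implicit Defensive.

Import Order.TTheory GRing.Theory Num.Theory.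
Import numFieldNormedType.Exports.

Local Open Scope classical_set_scope.
Local Open Scope ring_scope.

(* A measurableType must be pointed, so the fractal is a nonempty metric space
   with an arbitrary distinguished point, which no definition below uses. *)
#[short(type="pmetricType")]
HB.structure Definition PointedMetric (K : numDomainType) :=
  { M of Metric K M & isPointed M }.

Notation borel F := (g_sigma_algebraType (@open F)).

Section SelfSimilarSet.
Context {R : realType} {F : pmetricType R} {M : nat}.
Variables (psi : 'I_M -> F -> F) (pi : (nat -> 'I_M) -> F).

Definition psi_word (w : seq 'I_M) : F -> F :=
  foldr (fun i g => psi i \o g) id w.

Definition cell (w : seq 'I_M) : set F := range (psi_word w).

(* [mkseq w n] is the prefix w_1 ... w_n of the infinite word w.  The last
   field determines [pi]. *)
Record self_similar_set : Prop := {
  ss_alphabet : (2 <= M)%N ;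
  ss_connected : connected [set: F] ;
  ss_compact : compact [set: F] ;
  ss_injective : forall i, injective (psi i) ;
  ss_contraction : forall i, exists2 q : R, 0 <= q < 1 &
    forall x y, mdist (psi i x) (psi i y) <= q * mdist x y ;
  ss_cover : [set: F] = \bigcup_i range (psi i) ;
  ss_coding : forall w : nat -> 'I_M,
    \bigcap_n cell (mkseq w n) = [set pi w]
}.

Definition left_shift (w : nat -> 'I_M) : nat -> 'I_M := fun k => w k.+1.

Definition critical_set : set (nat -> 'I_M) :=
  pi @^-1` (\bigcup_(ij in [set ij : 'I_M * 'I_M | ij.1 != ij.2])
              (range (psi ij.1) `&` range (psi ij.2))).

Definition postcritical_set : set (nat -> 'I_M) :=
  \bigcup_(n in [set n | (1 <= n)%N]) (iter n left_shift @` critical_set).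

Definition pcf_self_similar_set : Prop :=
  self_similar_set /\ finite_set postcritical_set.

Definition bdry : set F := pi @` postcritical_set.

End SelfSimilarSet.

Section HarmonicStructure.
Context {R : realType} {F : pmetricType R} {M : nat}.
Variables (psi : 'I_M -> F -> F) (pi : (nat -> 'I_M) -> F).
Variables (a : F -> F -> R) (r : 'I_M -> R).
Local Notation F0 := (bdry psi pi).

Definition r_word (w : seq 'I_M) : R := \prod_(i <- w) r i.

(* The matrix A_0 is the restriction of [a] to F^0 x F^0.  A function on F^n is
   given by any f : F -> R: [energyn n f] depends only on the values of f on
   F^n. *)
Definition energy0 (f : F -> R) : R :=
  2^-1 * \sum_(x \in F0) \sum_(y \in F0) a x y * (f x - f y) ^+ 2.

Definition energyn (n : nat) (f : F -> R) : R :=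
  \sum_(w : n.-tuple 'I_M) (r_word w)^-1 * energy0 (f \o psi_word psi w).

Record regular_harmonic_structure : Prop := {
  hs_sym : forall x y, F0 x -> F0 y -> a x y = a y x ;
  hs_ge0 : forall x y, F0 x -> F0 y -> x != y -> 0 <= a x y ;
  hs_row : forall x, F0 x -> \sum_(y \in F0) a x y = 0 ;
  hs_irr : forall S : set F, S `<=` F0 -> S !=set0 -> S != F0 ->
    exists x y, [/\ S x, (F0 `\` S) y & a x y != 0] ;
  hs_regular : forall i, 0 < r i < 1 ;
  hs_min : forall f : F -> R,
    (exists2 g : F -> R, forall x, F0 x -> g x = f x & energyn 1 g = energy0 f) /\
    (forall g : F -> R, (forall x, F0 x -> g x = f x) -> energy0 f <= energyn 1 g)
}.

Definition form_dom (f : F -> R) : Prop :=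
  continuous f /\ has_ubound (range (fun n => energyn n f)).

Definition energy (f : F -> R) : R := limn (fun n => energyn n f).

Definition form (f g : F -> R) : R :=
  (energy (fun x => f x + g x) - energy (fun x => f x - g x)) / 4.

(* Extended-real-valued, with the library's convention 0^-1 = +oo, so that the
   definition does not presuppose that the infimum is positive. *)
Definition resistance (x y : F) : \bar R :=
  if x == y then 0%E
  else (ereal_inf [set (energy f)%:E |
          f in [set f | [/\ form_dom f, f x = 0%R & f y = 1%R]]])^-1%E.

Definition res_ball (x : F) (e : R) : set F :=
  [set y | (resistance x y <= e%:E)%E].

Definition rmin : R := \big[Num.min/1]_(i < M) r i.

(* Since 0 < r_i < 1 and M >= 2, the first field determines [dH]. *)
Record self_similar_measure (mu : set (borel F) -> \bar R) (dH : R) : Prop := {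
  ssm_dim : \sum_(i < M) r i `^ dH = 1 ;
  ssm_cell : forall w : seq 'I_M, mu (cell psi w) = (r_word w `^ dH)%:E
}.

Definition form_dom_b (b : set F) (f : F -> R) : Prop :=
  form_dom f /\ forall x, (F0 `\` b) x -> f x = 0.

End HarmonicStructure.

Definition inner {d} {X : measurableType d} {R : realType}
    (mu : {measure set X -> \bar R}) (f g : X -> R) : R :=
  \int[mu]_(x in [set: X]) (f x * g x).

Definition norm2 {d} {X : measurableType d} {R : realType}
    (mu : {measure set X -> \bar R}) (f : X -> R) : \bar R :=
  ('N[mu]_2%:E[EFin \o f])%E.

Section Spectral.
Context {R : realType} {F : pmetricType R} {M : nat}.
Variables (psi : 'I_M -> F -> F) (pi : (nat -> 'I_M) -> F).
Variables (a : F -> F -> R) (r : 'I_M -> R).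
Variables (mu : {measure set (borel F) -> \bar R}) (b : set F).
Local Notation Db := (form_dom_b psi pi a r b).

(* The graph of Delta_b: f belongs to its domain and Delta_b f = h. *)
Definition laplacian (f h : F -> R) : Prop :=
  [/\ Db f, (h : borel F -> R) \in Lfun mu 2%:E &
      forall g, Db g -> form psi pi a r f g = - inner mu h g].

(* Eigenpairs are numbered from 0: [phi k] is the (k+1)-st eigenfunction. *)
Record eigenbasis (lam : nat -> R) (phi : nat -> F -> R) : Prop := {
  eb_ge0 : forall k, 0 <= lam k ;
  eb_mono : {homo lam : k l / (k <= l)%N >-> k <= l} ;
  eb_eigen : forall k, laplacian (phi k) (fun x => - (lam k * phi k x)) ;
  eb_orthonormal : forall k l, inner mu (phi k) (phi l) = (k == l)%:R ;
  eb_basis : forall f : borel F -> R, f \in Lfun mu 2%:E ->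
    (fun K => norm2 mu (fun x =>
       f x - \sum_(k < K) inner mu f (phi k) * phi k x)) @ \oo --> 0%E
}.

End Spectral.

Section Probability.
Context {R : realType} {d : measure_display} {Om : measurableType d}.
Variable P : probability Om R.

(* The point mass at 0 is a (degenerate) centred Gaussian law; it is treated
   apart because the library's [normal_prob m 0] is not a point mass. *)
Definition centred_gaussian (X : Om -> R) : Prop :=
  measurable_fun [set: Om] X /\
  exists2 s : R, 0 <= s & forall A : set R, measurable A ->
    P (X @^-1` A) = if s == 0 then \d_(0 : R) A else normal_prob 0 s A.

Definition cvg_L2 (X_ : nat -> Om -> R) (X : Om -> R) : Prop :=
  (fun n => 'E_P[(fun o => (X_ n o - X o) ^+ 2)%R]%E) @ \oo --> 0%E.

(* A cylindrical Wiener process on L^2(mu): [W f t] is <f, W(t)>_mu, and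
   t |-> W f t is a Brownian motion with variance |f|^2 t.  A.s. linearity in f
   follows from the covariance. *)
Record cylindrical_wiener {dX} {X : measurableType dX}
    (mu : {measure set X -> \bar R}) (W : (X -> R) -> R -> {RV P >-> R}) :
    Prop := {
  cw_gaussian : forall (n : nat) (c : 'I_n -> R) (f : 'I_n -> X -> R)
      (t : 'I_n -> R),
    (forall i, f i \in Lfun mu 2%:E) -> (forall i, 0 <= t i) ->
    centred_gaussian (fun o => \sum_(i < n) c i * W (f i) (t i) o) ;
  cw_covariance : forall f g s t, f \in Lfun mu 2%:E -> g \in Lfun mu 2%:E ->
    0 <= s -> 0 <= t ->
    'E_P[(fun o => W f s o * W g t o)%R]%E = (Num.min s t * inner mu f g)%:E ;
  cw_continuous : forall f, f \in Lfun mu 2%:E ->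
    {ae P, forall o, {within `[0, +oo[, continuous (fun t => W f t o)}}
}.

(* Integral over [0, t] of a deterministic h against a Brownian motion B:
   L^2(P)-limit of the elementary integrals of step functions
   sum_(i < m) c_i 1_]s_i, s_i+1] that converge to h in L^2([0, t]). *)
Definition step_fun (m : nat) (s c : nat -> R) (x : R) : R :=
  \sum_(i < m) c i * \1_(`]s i, s i.+1]%classic) x.

Definition step_integral (B : R -> Om -> R) (m : nat) (s c : nat -> R)
    (o : Om) : R :=
  \sum_(i < m) c i * (B (s i.+1) o - B (s i) o).

Definition subdivision (t : R) (m : nat) (s : nat -> R) : Prop :=
  [/\ s 0%N = 0, s m = t & forall i, (i < m)%N -> s i <= s i.+1].

Definition is_wiener_integral (B : R -> Om -> R) (t : R) (h : R -> R)
    (X : Om -> R) : Prop :=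
  exists (m : nat -> nat) (s c : nat -> nat -> R),
  [/\ forall n, subdivision t (m n) (s n),
      (fun n => \int[lebesgue_measure]_(x in `[0%R, t])
         ((h x - step_fun (m n) (s n) (c n) x) ^+ 2)%R%:E)%E @ \oo --> 0%E &
      cvg_L2 (fun n => step_integral B (m n) (s n) (c n)) X].

End Probability.

(* v' is the derivative of v on [0, +oo[, one-sided at 0. *)
Definition derivative_on_ge0 {R : realType} (v v' : R -> R) : Prop :=
  forall t, 0 <= t ->
  (fun s => (v s - v t) / (s - t)) @ within [set s | 0 <= s] t^' --> v' t.

Definition damped_oscillator {R : realType} (beta lam : R) (v : R -> R) :
    Prop :=
  exists v' v'' : R -> R,
  [/\ derivative_on_ge0 v v', derivative_on_ge0 v' v'',
      forall t, 0 <= t -> v'' t + 2 * beta * v' t + lam * v t = 0,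
      v 0 = 0 & v' 0 = 1].

Section Solution.
Context {R : realType} {d : measure_display} {Om : measurableType d}.
Variable P : probability Om R.
Context {dX : measure_display} {X : measurableType dX}.
Variable mu : {measure set X -> \bar R}.

(* Y_k(t) is the stochastic integral over [0, t] of V(lambda_k, t - s) against
   the Brownian motion <phi_k, W>. *)
Definition mode_processes (W : (X -> R) -> R -> {RV P >-> R})
    (V : R -> R -> R) (lam : nat -> R) (phi : nat -> X -> R)
    (Y : nat -> R -> {RV P >-> R}) : Prop :=
  forall k t, 0 <= t ->
  is_wiener_integral P (fun s => W (phi k) s) t
    (fun s => V (lam k) (t - s)) (Y k t).

(* The L^2(mu)-valued process u(t) = sum_k Y_k(t) phi_k, the series converging
   in L^2(Om; L^2(mu)), in a version with continuous paths in L^2(mu).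
   [u t o] is a representative of the value at o; as L^2(mu) is separable,
   weak measurability in o is measurability. *)
Record spde_solution (Y : nat -> R -> {RV P >-> R}) (phi : nat -> X -> R)
    (u : R -> Om -> X -> R) : Prop := {
  sol_Lfun : forall t o, 0 <= t -> u t o \in Lfun mu 2%:E ;
  sol_measurable : forall t g, 0 <= t -> g \in Lfun mu 2%:E ->
    measurable_fun [set: Om] (fun o => inner mu (u t o) g) ;
  sol_continuous : {ae P, forall o, forall t, 0 <= t ->
    (fun s => norm2 mu (fun x => u s o x - u t o x))
      @ within [set s | 0 <= s] (nbhs t) --> 0%E} ;
  sol_series : forall t, 0 <= t ->
    (fun K => \int[P]_o (norm2 mu (fun x =>
       u t o x - \sum_(k < K) Y k t o * phi k x)%R ^+ 2))%E @ \oo --> 0%E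
}.

End Solution.

Section Neighbourhoods.
Context {R : realType} {F : pmetricType R} {M : nat}.
Variables (psi : 'I_M -> F -> F) (pi : (nat -> 'I_M) -> F).
Variables (a : F -> F -> R) (r : 'I_M -> R).
Variables (mu : {measure set (borel F) -> \bar R}) (dH : R).

Record neighbourhoods (c5 : R) (D : F -> nat -> set (borel F)) : Prop := {
  nb_measurable : forall x n, measurable (D x n) ;
  nb_measure : forall x n,
    ((rmin r `^ dH * 2 `^ (- (dH * n%:R)))%:E < mu (D x n))%E ;
  nb_center : forall x n, D x n x ;
  nb_ball : forall x n, D x n `<=` res_ball psi pi a r x (c5 * 2 ^- n)
}.

Definition normalized_indicator (A : set (borel F)) : borel F -> R :=
  fun y => (fine (mu A))^-1 * \1_A y.

End Neighbourhoods.

(* Main.v *)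
Require Import Defs.
From mathcomp Require Import all_boot all_order all_algebra.
From mathcomp Require Import all_classical all_reals all_analysis.
From mathcomp Require Import measurable_realfun.
From mathcomp Require Import ring lra.

Set Implicit Arguments.
Unset Strict Implicit.
Unset Printing Implicit Defensive.

Import Order.TTheory GRing.Theory Num.Theory.
Import numFieldNormedType.Exports.

Local Open Scope classical_set_scope.
Local Open Scope ring_scope.

(** For a bounded functional [l] on the form domain write
    [S l := sum_k l(phi_k)^2 / (1 + lam_k)].  If
    [l(g)^2 <= C (E(g,g) + <g,g>)] for all [g], then taking
    [g = sum_k l(phi_k) / (1 + lam_k) phi_k] gives [S l <= C].  Since
    [(g(x) - g(y))^2 <= R(x,y) E(g,g)], the functional
    [l(g) = <g,f_n^x> - g(x)] has [S l <= c5 2^-n], and evaluation at [x],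
    which differs from a bounded functional on [L^2] by such an [l], has finite
    [S l].
    An exponentially weighted energy of the damped oscillator bounds
    [(1 + lam) V(s)^2] by [exp (2 gam s)] with
    [gam = sqrt (beta^2 + 1) - beta], so by the Ito isometry
    [sum_k l(phi_k) Y_k(t)] has second moment at most a constant times
    [exp (2 gam t) S l].  This yields both the [L^2] convergence of the series
    at [x] and the estimate; the limit is Gaussian because mean square limits
    of centred Gaussian variables are. *)

(** * Energy and resistance *)

(** The weight is [1 + lam] and not [lam] because zero eigenvalues occur: for [b] equal to F^0 the
    constants lie in the domain and have energy 0. The duality argument runs over the first [K]
    modes with bounds uniform in [K], so that the test function is always a finite combination of
    eigenfunctions and hence lies in the form domain.

    The obstacle on the probabilistic side is that each [Y k t] is given only as a mean square limit
    of step integrals, along step functions that may differ from mode to mode. Second moments and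
    Gaussian laws are therefore established for finite linear combinations of values of [W], where
    covariances are explicit, and then passed to the limit. Each passage costs a factor 2 from (x +
    y)^2 <= 2 x^2 + 2 y^2, which the constant of the theorem absorbs.

    For the Gaussian limit, a cluster point of the standard deviations serves as the standard
    deviation of the limit; the probabilities of rays are compared along a subsequence, and the
    cluster point 0 leads to the point mass. *)

Section Energy.
Context {R : realType} {F : pmetricType R} {M : nat}.
Variables (psi : 'I_M -> F -> F) (pi : (nat -> 'I_M) -> F).
Variables (a : F -> F -> R) (r : 'I_M -> R).
Local Notation F0 := (bdry psi pi).
Hypothesis F0_fin : finite_set F0.
Hypothesis hA : regular_harmonic_structure psi pi a r.

Local Notation X0 := (finmap.enum_fset (fset_set F0)).
Local Notation En := (energyn psi pi a r).
Local Notation dom := (form_dom psi pi a r).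
Local Notation energy := (energy psi pi a r).
Local Notation form := (Defs.form psi pi a r).

(** [form] polarises after taking the limit in [n]. At a fixed level the polarised energy is an
    explicit finite sum, so bilinearity is checked there and inherited by the limit. *)
Definition bform0 (f g : F -> R) : R :=
  2^-1 * \sum_(x <- X0) \sum_(y <- X0) a x y * ((f x - f y) * (g x - g y)).

Definition bform (n : nat) (f g : F -> R) : R :=
  \sum_(w : n.-tuple 'I_M) (r_word r w)^-1 *
    bform0 (f \o psi_word psi w) (g \o psi_word psi w).

Lemma bform0_diag f : energy0 psi pi a f = bform0 f f.
Proof.
rewrite /energy0 /bform0 fsbig_finite//=; congr (_ * _).
by apply: eq_bigr => x _; rewrite fsbig_finite.
Qed.

Lemma bform_diag n f : En n f = bform n f f.
Proof. by apply: eq_bigr => w _; rewrite bform0_diag. Qed.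

Lemma bform0C f g : bform0 f g = bform0 g f.
Proof.
by congr (_ * _); apply: eq_bigr => x _; apply: eq_bigr => y _; rewrite [X in _ * X]mulrC.
Qed.

Lemma bformC n f g : bform n f g = bform n g f.
Proof. by apply: eq_bigr => w _; rewrite bform0C. Qed.

(** One affine shape covers sums, multiples and shifts. The constant [d] disappears because only
    differences of values enter; shifts are what normalises the test function in
    [resistance_bound]. *)
Lemma bform0P f g h c d :
  bform0 (fun x => c * f x + g x + d) h = c * bform0 f h + bform0 g h.
Proof.
rewrite /bform0 mulrCA -mulrDr; congr (_ * _).
rewrite mulr_sumr -big_split/=; apply: eq_bigr => x _; rewrite mulr_sumr -big_split/=.
by apply: eq_bigr => y _; ring.
Qed.

Lemma bformP n f g h c d :
  bform n (fun x => c * f x + g x + d) h = c * bform n f h + bform n g h.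
Proof.
rewrite /bform mulr_sumr -big_split/=; apply: eq_bigr => w _.
by rewrite (bform0P (f \o psi_word psi w) (g \o psi_word psi w)); ring.
Qed.

Lemma bform0_ge0 f : 0 <= bform0 f f.
Proof.
rewrite mulr_ge0// big_seq; apply: sumr_ge0 => x xX.
rewrite big_seq; apply: sumr_ge0 => y yX.
have [<-|xy] := eqVneq x y; first by rewrite subrr !mulr0.
rewrite mulr_ge0 ?(hs_ge0 hA)// -?expr2 ?sqr_ge0//.
  by move: xX; rewrite in_fset_set// inE.
by move: yX; rewrite in_fset_set// inE.
Qed.

Lemma r_word_gt0 w : 0 < r_word r w.
Proof. by apply: prodr_gt0 => i _; case/andP: (hs_regular hA i). Qed.

Lemma energyn_ge0 n f : 0 <= En n f.
Proof.
rewrite bform_diag; apply: sumr_ge0 => w _.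
by rewrite mulr_ge0 ?bform0_ge0// invr_ge0 ltW// r_word_gt0.
Qed.

Lemma sum_tuple_cons n (G : seq 'I_M -> R) :
  \sum_(w : n.+1.-tuple 'I_M) G w =
  \sum_(i < M) \sum_(w : n.-tuple 'I_M) G (i :: w).
Proof.
rewrite pair_bigA/=.
pose h (p : 'I_M * n.-tuple 'I_M) : n.+1.-tuple 'I_M := [tuple of p.1 :: p.2].
rewrite (reindex h)//=; apply: onW_bij.
exists (fun w => (thead w, [tuple of behead w])) => [[i w]|w].
  by congr (_, _); apply: val_inj.
by apply: val_inj => /=; rewrite [in RHS](tuple_eta w).
Qed.

Lemma energyn0 f : En 0 f = energy0 psi pi a f.
Proof.
rewrite /energyn (bigD1 [tuple])//= big1 ?addr0.
  by rewrite /r_word big_nil invr1 mul1r.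
by move=> w /eqP; rewrite (_ : w = [tuple])//; exact: tuple0.
Qed.

Lemma energynS n f : En n.+1 f = \sum_(i < M) (r i)^-1 * En n (f \o psi i).
Proof.
rewrite /energyn (@sum_tuple_cons _
  (fun w => (r_word r w)^-1 * energy0 psi pi a (f \o psi_word psi w))).
apply: eq_bigr => i _; rewrite mulr_sumr; apply: eq_bigr => w _.
by rewrite mulrA /r_word big_cons invfM.
Qed.

(** The harmonic structure gives the step from level 0 to level 1, since [f] extends its own
    boundary values. Self-similarity ([energynS]) carries this into every cell. *)
Lemma energyn_nondecreasing f : nondecreasing_seq (En ^~ f).
Proof.
apply/nondecreasing_seqP => n; elim: n f => [|n IH] f.
  by rewrite energyn0; case: (hs_min hA f) => _; apply.
rewrite energynS (energynS n.+1); apply: ler_sum => i _.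
rewrite ler_wpM2l// invr_ge0 ltW//; by case/andP: (hs_regular hA i).
Qed.

Lemma form_dom_cvg f : dom f -> cvgn (En ^~ f).
Proof.
move=> [_ ub]; apply: nondecreasing_is_cvgn => //; exact: energyn_nondecreasing.
Qed.

Lemma energyn_le f n : dom f -> En n f <= energy f.
Proof.
by move=> df; apply: nondecreasing_cvgn_le;
  [exact: energyn_nondecreasing|exact: form_dom_cvg].
Qed.

Lemma energy_ge0 f : dom f -> 0 <= energy f.
Proof. by move=> df; apply: le_trans (energyn_ge0 0 f) _; exact: energyn_le. Qed.

Lemma energynD n f g c d : En n (fun x => c * f x + g x + d) =
  c ^+ 2 * En n f + 2 * c * bform n f g + En n g.
Proof.
rewrite !bform_diag; set h := (h in bform n h h).
rewrite {1}/h bformP (bformC n f h) (bformC n g h) /h !bformP.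
by rewrite (bformC n g f); ring.
Qed.

Lemma form_domD f g c d : dom f -> dom g -> dom (fun x => c * f x + g x + d).
Proof.
move=> df dg; split.
  move=> x; apply: cvgD; last exact: cvg_cst.
  apply: cvgD; last by case: dg => + _; apply.
  by apply: cvgMr; case: df => + _; apply.
exists (2 * (c ^+ 2 * energy f + energy g)) => _ [n _ <-].
(* Half of the parallelogram law: the energy of [c f + g] is at most the sum of the energies of
   [c f + g] and [- c f + g], in which the cross terms cancel. *)
have := energyn_ge0 n (fun x => - c * f x + g x + 0).
rewrite !energynD sqrrN => H.
apply: (@le_trans _ _ (2 * (c ^+ 2 * En n f + En n g))); first by lra.
by rewrite ler_wpM2l// lerD// ?ler_wpM2l ?sqr_ge0// energyn_le.
Qed.

Lemma form_dom_cst c : dom (cst c).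
Proof.
split; first by move=> x; exact: cvg_cst.
exists 0 => _ [n _ <-]; rewrite bform_diag/bform big1// => w _.
rewrite /bform0 big1 ?mulr0// => x _; rewrite big1// => y _.
by rewrite subrr !mulr0.
Qed.

Lemma cvg_bform f g : dom f -> dom g -> bform n f g @[n --> \oo] --> form f g.
Proof.
move=> df dg; rewrite /Defs.form.
have -> : (fun x => f x + g x) = (fun x => 1 * f x + g x + 0) by apply/funext => x; ring.
have -> : (fun x => f x - g x) = (fun x => -1 * g x + f x + 0) by apply/funext => x; ring.
have -> : (fun n => bform n f g) = (fun n => (En n (fun x => 1 * f x + g x + 0) -
    En n (fun x => -1 * g x + f x + 0)) / 4).
  by apply/funext => n; rewrite !energynD (bformC n g f); field.
apply: cvgMl; apply: cvgB; apply: form_dom_cvg; exact: form_domD.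
Qed.

Lemma form_lim f g : dom f -> dom g -> form f g = limn (fun n => bform n f g).
Proof. by move=> df dg; apply/esym/cvg_lim => //; exact: cvg_bform. Qed.

Lemma formC f g : dom f -> dom g -> form f g = form g f.
Proof.
by move=> df dg; rewrite !form_lim//; congr (limn _); apply/funext => n; exact: bformC.
Qed.

Lemma energy_form f : dom f -> energy f = form f f.
Proof.
by move=> df; rewrite form_lim//; congr (limn _); apply/funext => n; exact: bform_diag.
Qed.

Lemma formP f g h c d : dom f -> dom g -> dom h ->
  form (fun x => c * f x + g x + d) h = c * form f h + form g h.
Proof.
move=> df dg dh; rewrite form_lim//; last exact: form_domD.
apply/cvg_lim => //; under eq_fun do rewrite bformP.
by apply: cvgD; [apply: cvgMr|]; exact: cvg_bform.
Qed.

Lemma energyP f c d : dom f -> energy (fun x => c * f x + d) = c ^+ 2 * energy f.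
Proof.
move=> df.
have -> : (fun x => c * f x + d) = (fun x => c * f x + cst 0 x + d).
  by apply/funext => x; rewrite addr0.
have d0 := form_dom_cst 0.
have F0h h : dom h -> form (cst 0) h = 0.
  move=> dh; have := formP 1 0 d0 d0 dh.
  have -> : (fun x : F => 1 * cst 0 x + cst 0 x + 0) = cst 0 :> (F -> R).
    by apply/funext => x /=; ring.
  lra.
have dd := form_domD c d df d0.
rewrite !energy_form// formP// F0h// formC// formP// F0h//; ring.
Qed.

(** If [f x] and [f y] differ, rescaling and shifting [f] to the values 0 at [x] and 1 at [y] makes
    it a competitor in the infimum, which is thus at most [energy f / (f x - f y)^2]. *)
Lemma resistance_bound f x y e : dom f ->
  (resistance psi pi a r x y <= e%:E)%E -> 0 <= e ->
  (f x - f y) ^+ 2 <= e * energy f.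
Proof.
move=> df + e0; rewrite /resistance; case: eqVneq => [<- _|xy].
  by rewrite subrr expr0n mulr_ge0// energy_ge0.
have [fxy|fxy] := eqVneq (f x) (f y).
  by move=> _; rewrite fxy subrr expr0n mulr_ge0// energy_ge0.
set S := (X in ereal_inf X); set I := ereal_inf S => H.
have S0 : lbound S 0%E.
  by move=> _ [g /= [dg _ _] <-]; rewrite lee_fin energy_ge0.
have I0 : (0 <= I)%E by exact: le_ereal_inf_tmp.
pose c := (f y - f x)^-1.
have fyx : f y - f x != 0 by rewrite subr_eq0 eq_sym.
have IE : (I <= (c ^+ 2 * energy f)%:E)%E.
  apply: ereal_inf_lbound; exists (fun z => c * f z + - (c * f x)).
    split; last 2 first.
    - by rewrite subrr.
    - by rewrite -mulrBr mulVf.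
    have -> : (fun z => c * f z - c * f x) = (fun z => c * f z + cst 0 z - c * f x).
      by apply/funext => z; rewrite addr0.
    by apply: form_domD => //; exact: form_dom_cst.
  by rewrite energyP.
move: I0 IE H; case: I => [i| |]//.
(* A zero infimum would mean resistance [+oo], which the real bound [e] rules out. *)
rewrite !lee_fin => i0 IE; rewrite inver; case: eqVneq => // i1.
have ip : 0 < i by rewrite lt_neqAle eq_sym i1.
rewrite lee_fin -div1r ler_pdivrMr// => H.
have c2 : 0 < c ^+ 2 by rewrite exprn_even_gt0//= invr_neq0.
have -> : (f x - f y) ^+ 2 = (c ^+ 2)^-1 by rewrite /c -exprVn invrK -sqrrN opprB.
rewrite -div1r ler_pdivrMr// (le_trans H)// -mulrA ler_wpM2l//.
by rewrite mulrC.
Qed.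
End Energy.

(** * The inner product of [L^2] *)

Section InnerProduct.
Context {d} {T : measurableType d} {R : realType}.
Variable mu : {measure set T -> \bar R}.
Local Notation L2 := (Lfun mu 2%:E).

Lemma L2_measurable f : f \in L2 -> measurable_fun [set: T] f.
Proof. by move/sub_Lfun_mfun; rewrite inE. Qed.

Lemma L2_normE (f : T -> R) :
  (\int[mu]_x (`|(EFin \o f) x| `^ 2) = \int[mu]_x (f x ^+ 2)%:E)%E.
Proof.
apply: eq_integral => x _ /=.
by rewrite powR_mulrn// real_normK// num_real.
Qed.

Lemma L2_iff (f : T -> R) : f \in L2 <->
  measurable_fun [set: T] f /\ (\int[mu]_x (f x ^+ 2)%:E < +oo)%E.
Proof.
split=> [fL|[mf fi]].
  split; first exact: L2_measurable.
  move/integrableP: (Lfun2_integrable_sqr fL) => [_].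
  by under eq_integral do rewrite /= ger0_norm ?sqr_ge0//.
rewrite inE; apply/andP; split; rewrite inE//= /finite_norm unlock L2_normE.
exact: poweR_lty.
Qed.

Lemma norm2_sqr (f : T -> R) : (norm2 mu f ^+ 2 = \int[mu]_x (f x ^+ 2)%:E)%E.
Proof.
have I0 : (0 <= \int[mu]_x (`|(EFin \o f) x| `^ 2))%E.
  by apply: integral_ge0 => x _; exact: poweR_ge0.
rewrite /norm2 unlock poweR12_sqrt// -L2_normE.
exact: sqr_sqrte.
Qed.

Lemma L2_integrableM f g : f \in L2 -> g \in L2 ->
  mu.-integrable [set: T] (fun x => (f x * g x)%:E).
Proof. by move=> fL gL; apply/Lfun1_integrable; exact: Lfun2_mul_Lfun1. Qed.

Lemma L2_lincomb f g c : f \in L2 -> g \in L2 -> (fun x => c * f x + g x) \in L2.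
Proof.
move=> fL gL.
have p2 : (1 <= 2%:E :> \bar R)%E by rewrite lee_fin ler1n.
apply: (Lfun_addr_closed mu p2).2 => //.
have := Lfun_scale c (ltW (ltr1n R 2)) fL.
by rewrite (_ : c \o* f = fun x => c * f x)//; apply/funext => x /=; rewrite mulrC.
Qed.

Lemma L2_sum (I : Type) (s : seq I) (c : I -> R) (f : I -> T -> R) :
  (forall i, f i \in L2) -> (fun x => \sum_(i <- s) c i * f i x) \in L2.
Proof.
move=> fL; elim: s => [|i s IH].
  under eq_fun do rewrite big_nil.
  apply/L2_iff; split=> //.
  by under eq_integral do rewrite expr0n/=; rewrite integral0 ltry.
under eq_fun do rewrite big_cons.
exact: L2_lincomb.
Qed.

Lemma innerC f g : inner mu f g = inner mu g f.
Proof. by apply: eq_Rintegral => x _; rewrite mulrC. Qed.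

Lemma inner_ge0 f : 0 <= inner mu f f.
Proof. by apply: Rintegral_ge0 => x _; rewrite -expr2 sqr_ge0. Qed.

Lemma innerP f g h c : f \in L2 -> g \in L2 -> h \in L2 ->
  inner mu (fun x => c * f x + g x) h = c * inner mu f h + inner mu g h.
Proof.
move=> fL gL hL; rewrite /inner.
under eq_Rintegral do rewrite mulrDl -mulrA.
rewrite RintegralD//; first by rewrite RintegralZl//; exact: L2_integrableM.
- exact: (integrableZl measurableT c (L2_integrableM fL hL)).
- exact: L2_integrableM.
Qed.

Lemma inner0l h : inner mu (fun=> 0) h = 0.
Proof. by rewrite /inner; under eq_Rintegral do rewrite mul0r; rewrite /Rintegral integral0. Qed.

Lemma inner_suml (I : Type) (s : seq I) (c : I -> R) (f : I -> T -> R) h :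
  (forall i, f i \in L2) -> h \in L2 ->
  inner mu (fun x => \sum_(i <- s) c i * f i x) h = \sum_(i <- s) c i * inner mu (f i) h.
Proof.
move=> fL hL; elim: s => [|i s IH].
  by under eq_fun do rewrite big_nil; rewrite big_nil inner0l.
under eq_fun do rewrite big_cons.
by rewrite big_cons -IH; apply: innerP => //; exact: L2_sum.
Qed.

Lemma inner_sumr (I : Type) (s : seq I) (c : I -> R) (f : I -> T -> R) h :
  (forall i, f i \in L2) -> h \in L2 ->
  inner mu h (fun x => \sum_(i <- s) c i * f i x) = \sum_(i <- s) c i * inner mu h (f i).
Proof.
move=> fL hL; rewrite innerC inner_suml//.
by apply: eq_bigr => i _; rewrite innerC.
Qed.

Lemma inner_sqr f : f \in L2 -> (\int[mu]_x (f x ^+ 2)%:E = (inner mu f f)%:E)%E.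
Proof.
move=> fL; rewrite /inner /Rintegral fineK//.
exact/integral_fune_fin_num/L2_integrableM.
Qed.

Lemma cauchy_schwarz f g : f \in L2 -> g \in L2 ->
  inner mu f g ^+ 2 <= inner mu f f * inner mu g g.
Proof.
move=> fL gL.
have H s : 0 <= inner mu f f + 2 * s * inner mu f g + s ^+ 2 * inner mu g g.
  have := L2_lincomb s gL fL; set h := (fun x => _) => hL.
  have := inner_ge0 h; rewrite {1}/h innerP// (innerC g h) (innerC f h) /h !innerP// (innerC g f).
  by congr (_ <= _); ring.
have gg := inner_ge0 g.
have [g0|g0] := eqVneq (inner mu g g) 0.
  rewrite g0 mulr0; have [->|fg0] := eqVneq (inner mu f g) 0; first by rewrite expr0n.
  (* With [inner mu g g = 0] the polynomial in [s] is affine; this [s] gives it the value -1,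
     contradicting its nonnegativity. *)
  have := H (- (inner mu f f + 1) / (2 * inner mu f g)).
  rewrite g0 mulr0 addr0.
  have -> : 2 * (- (inner mu f f + 1) / (2 * inner mu f g)) * inner mu f g =
    - (inner mu f f + 1) by field.
  by move=> ?; exfalso; lra.
have gp : 0 < inner mu g g by rewrite lt_neqAle eq_sym g0.
(* The minimiser of the quadratic polynomial in [s]. *)
have := H (- inner mu f g / inner mu g g).
rewrite -(pmulr_lge0 _ gp).
have -> : (inner mu f f + 2 * (- inner mu f g / inner mu g g) * inner mu f g +
   (- inner mu f g / inner mu g g) ^+ 2 * inner mu g g) * inner mu g g =
   inner mu f f * inner mu g g - inner mu f g ^+ 2 by field.
by rewrite subr_ge0.
Qed.

End InnerProduct.

(** * Resolvent bounds *)

Lemma L2_bounded {d} {T : measurableType d} {R : realType}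
    (mu : probability T R) (f : T -> R) (c : R) :
  measurable_fun [set: T] f -> (forall x, `|f x| <= c) -> f \in Lfun mu 2%:E.
Proof.
move=> mf fc; apply/L2_iff; split=> //.
apply: (@le_lt_trans _ _ (\int[mu]_x (cst (c ^+ 2)%:E x))%E).
  apply: ge0_le_integral => //.
  - by move=> x _; rewrite lee_fin sqr_ge0.
  - by apply/measurable_EFinP; exact: measurable_funX.
  - move=> x _; rewrite lee_fin -[leLHS]real_normK ?num_real//.
    by rewrite lerXn2r ?nnegrE// (le_trans _ (fc x)).
exact: (integrable_lty measurableT (finite_measure_integrable_cst mu (c ^+ 2) measurableT)).
Qed.

(* The extremal choice is [c k = l k / w k]. *)
Lemma dual_sum_le {R : realType} (K : nat) (l w : nat -> R) (C : R) :
  (forall k, 0 < w k) -> 0 <= C ->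
  (forall c : nat -> R, (\sum_(k < K) c k * l k) ^+ 2 <= C * \sum_(k < K) c k ^+ 2 * w k) ->
  \sum_(k < K) l k ^+ 2 / w k <= C.
Proof.
move=> w0 C0 /(_ (fun k => l k / w k)).
have -> : \sum_(k < K) l k / w k * l k = \sum_(k < K) l k ^+ 2 / w k.
  by apply: eq_bigr => k _; ring.
have -> : \sum_(k < K) (l k / w k) ^+ 2 * w k = \sum_(k < K) l k ^+ 2 / w k.
  by apply: eq_bigr => k _; have := w0 k; move=> ?; field; lra.
set S := \sum_(k < K) _.
have : 0 <= S by apply: sumr_ge0 => k _; rewrite divr_ge0 ?sqr_ge0// ltW.
rewrite le_eqVlt => /orP[/eqP <-|S0 H]; last by rewrite -(ler_pM2r S0) -expr2.
by [].
Qed.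

Section SpectralBounds.
Context {R : realType} {F : pmetricType R} {M : nat}.
Variables (psi : 'I_M -> F -> F) (pi : (nat -> 'I_M) -> F).
Variables (a : F -> F -> R) (r : 'I_M -> R).
Hypothesis F0_fin : finite_set (bdry psi pi).
Hypothesis hA : regular_harmonic_structure psi pi a r.
Variables (mu : probability (borel F) R) (b : set F).
Variables (lam : nat -> R) (phi : nat -> F -> R).
Hypothesis hphi : eigenbasis psi pi a r mu b lam phi.
Local Notation dom := (form_dom psi pi a r).
Local Notation energy := (Defs.energy psi pi a r).
Local Notation form := (Defs.form psi pi a r).
Local Notation L2 := (Lfun mu 2%:E).

Lemma continuous_borel_measurable (f : F -> R) :
  continuous f -> measurable_fun [set: borel F] (f : borel F -> R).
Proof.
move=> cf; apply: (measurability (@RGenOpens.G R)) => //.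
  exact: RGenOpens.measurableE.
move=> _ [_ [x [y ->]] <-]; rewrite setTI.
apply: sub_sigma_algebra.
by move/continuousP: cf; apply; exact: interval_open.
Qed.

Lemma eigenfun_dom k : dom (phi k).
Proof. by case: (eb_eigen hphi k) => -[]. Qed.

(** [laplacian] puts [lam k * phi k] in L^2, which says nothing when [lam k = 0]. Normalisation
    settles all cases: an infinite integral of the square would have real part 0 instead of 1. *)
Lemma eigenfun_L2 k : (phi k : borel F -> R) \in L2.
Proof.
apply/L2_iff; split.
  by apply: continuous_borel_measurable; case: (eigenfun_dom k).
have := eb_orthonormal hphi k k; rewrite eqxx /inner/Rintegral.
under eq_integral do rewrite -expr2.
set I := integral _ _ _; have : (0 <= I)%E by apply: integral_ge0 => x _; rewrite lee_fin sqr_ge0.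
case: I => [s _ _|_ /esym/eqP|]//=; first by rewrite ltry.
by rewrite oner_eq0.
Qed.

Definition eigensum (K : nat) (c : nat -> R) (x : F) : R := \sum_(k < K) c k * phi k x.

Lemma eigensumS K c :
  eigensum K.+1 c = fun x => c K * phi K x + eigensum K c x + 0.
Proof. by apply/funext => x; rewrite /eigensum big_ord_recr/= addrC addr0. Qed.

Lemma eigensum_dom K c : dom (eigensum K c).
Proof.
elim: K => [|K IH].
  have -> : eigensum 0 c = cst 0 by apply/funext => x; rewrite /eigensum big_ord0.
  exact: form_dom_cst.
by rewrite eigensumS; apply: form_domD => //; exact: eigenfun_dom.
Qed.

Lemma eigensum_L2 K c : (eigensum K c : borel F -> R) \in L2.
Proof. by apply: (L2_sum (index_enum 'I_K) (fun k => c k)) => k; exact: eigenfun_L2. Qed.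

Lemma form_eigensuml K c g : dom g ->
  form (eigensum K c) g = \sum_(k < K) c k * form (phi k) g.
Proof.
move=> dg; elim: K => [|K IH].
  rewrite big_ord0 (_ : eigensum 0 c = fun x => 0 * g x + 0) //; last first.
    by apply/funext => x; rewrite /eigensum big_ord0 mul0r addr0.
  have := formP F0_fin hA (-1) 0 dg dg dg.
  rewrite (_ : (fun x => -1 * g x + g x + 0) = fun x => 0 * g x + 0); last by apply/funext => x; ring.
  by move=> ->; ring.
rewrite eigensumS formP//; [|exact: eigenfun_dom|exact: eigensum_dom].
by rewrite IH big_ord_recr/= addrC.
Qed.

Lemma inner_eigensum K c k : inner mu (phi k) (eigensum K c) = if (k < K)%N then c k else 0.
Proof.
rewrite (inner_sumr (index_enum 'I_K) (fun k => c k))//; [|by move=> ?; exact: eigenfun_L2|exact: eigenfun_L2].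
under eq_bigr do rewrite (eb_orthonormal hphi).
case: ifPn => kK.
  rewrite (bigD1 (Ordinal kK))//= eqxx mulr1 big1 ?addr0// => j jk.
  rewrite (_ : (k == j) = false) ?mulr0//.
  by apply/negbTE; rewrite eq_sym.
rewrite big1// => j _; rewrite (_ : (k == j) = false) ?mulr0//.
by apply/negbTE; apply: contraNneq kK => ->.
Qed.

Lemma inner_eigensum_diag K c :
  inner mu (eigensum K c) (eigensum K c) = \sum_(k < K) c k ^+ 2.
Proof.
rewrite (inner_suml (index_enum 'I_K) (fun k => c k))//; [|by move=> ?; exact: eigenfun_L2|exact: eigensum_L2].
by apply: eq_bigr => k _; rewrite inner_eigensum ltn_ord expr2.
Qed.

(** The weak eigenvalue equation is tested against the sum itself, which vanishes on the boundary
    outside [b] because every eigenfunction does. *)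
Lemma energy_eigensum K c : energy (eigensum K c) = \sum_(k < K) c k ^+ 2 * lam k.
Proof.
have dE := eigensum_dom K c.
rewrite energy_form// form_eigensuml//; apply: eq_bigr => k _.
case: (eb_eigen hphi k) => _ _ ->; last first.
  split=> // x bx; rewrite /eigensum big1// => j _.
  by case: (eb_eigen hphi j) => -[_ ->]//; rewrite mulr0.
have -> : inner mu (fun x => - (lam k * phi k x)) (eigensum K c) =
    - lam k * inner mu (phi k) (eigensum K c).
  rewrite /inner -RintegralZl//; last exact: L2_integrableM (eigenfun_L2 _) (eigensum_L2 _ _).
  by apply: eq_Rintegral => x _; ring.
by rewrite inner_eigensum ltn_ord; ring.
Qed.

Lemma lam1_gt0 k : 0 < 1 + lam k.
Proof. by rewrite ltr_pwDl// (eb_ge0 hphi). Qed.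

(** * Evaluation at a point compared with the average over a small set *)

Section OnePoint.
Variables (D : set (borel F)) (x : F) (e : R).
Hypothesis mD : measurable D.
Hypothesis muD : (0 < mu D)%E.
Hypothesis e0 : 0 <= e.
Hypothesis DB : D `<=` res_ball psi pi a r x e.
Local Notation f := (normalized_indicator mu D).

Lemma fine_muD_gt0 : 0 < fine (mu D).
Proof. by rewrite fine_gt0// muD (le_lt_trans (probability_le1 _ _))// ltry. Qed.

Lemma normalized_indicator_ge0 y : 0 <= f y.
Proof. by rewrite mulr_ge0// invr_ge0 ltW// fine_muD_gt0. Qed.

Lemma normalized_indicator_measurable : measurable_fun [set: borel F] f.
Proof. exact: measurable_funM. Qed.

Lemma normalized_indicator_L2 : f \in L2.
Proof.
apply: (@L2_bounded _ _ _ _ _ (fine (mu D))^-1); first exact: normalized_indicator_measurable.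
move=> y; rewrite ger0_norm ?normalized_indicator_ge0//; apply: ler_piMr.
  by rewrite invr_ge0 ltW// fine_muD_gt0.
by rewrite indicE; case: (_ \in _).
Qed.

Lemma Rintegral_normalized_indicator : \int[mu]_(y in [set: borel F]) f y = 1.
Proof.
rewrite /normalized_indicator RintegralZl//; last exact: integrable_indic.
rewrite /Rintegral integral_indic// setIT mulVf// gt_eqF// fine_muD_gt0//.
Qed.

(** The normalised indicator is a probability density carried by a resistance ball, so the
    difference is a mean of [g y - g x], each term being at most the square root of
    [e * energy g]. *)
Lemma average_oscillation g : dom g -> (g : borel F -> R) \in L2 ->
  (inner mu g f - g x) ^+ 2 <= e * energy g.
Proof.
move=> dg gL; have fL := normalized_indicator_L2.
have eE : 0 <= e * energy g by rewrite mulr_ge0// energy_ge0.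
have fI : mu.-integrable [set: borel F] (EFin \o f).
  by apply/Lfun1_integrable/Lfun_subset12 => //; exact: fin_num_measure.
have E : inner mu g f - g x = \int[mu]_(y in [set: borel F]) ((g y - g x) * f y).
  rewrite -[X in _ - X]mulr1 -Rintegral_normalized_indicator -RintegralZl//.
  rewrite -RintegralB//; last 2 first.
  - exact: L2_integrableM.
  - exact: (integrableZl measurableT (g x) fI).
  by apply: eq_Rintegral => y _; rewrite mulrBl.
have gfI : mu.-integrable [set: borel F] (EFin \o (fun y => (g y - g x) * f y)).
  apply: (L2_integrableM _ fL).
  rewrite (_ : (fun y => _) = fun y => -1 * cst (g x) y + g y); last by apply/funext => y /=; ring.
  by apply: L2_lincomb => //; apply: (@L2_bounded _ _ _ _ _ `|g x|).
suff : `|inner mu g f - g x| <= Num.sqrt (e * energy g).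
  move=> H; rewrite -real_normK ?num_real// -[leRHS]sqr_sqrtr//.
  by rewrite lerXn2r ?nnegrE ?sqrtr_ge0.
rewrite E (le_trans (le_normr_Rintegral _ gfI))//.
rewrite -[leRHS]mulr1 -Rintegral_normalized_indicator -RintegralZl//.
apply: le_Rintegral => //.
- exact: integrable_norm.
- exact: (integrableZl measurableT _ fI).
move=> y _ /=; rewrite normrM (ger0_norm (normalized_indicator_ge0 y)).
(* Off [D] the density vanishes, so the resistance estimate is called only inside the ball. *)
have [yD|yD] := pselect (D y); last first.
  by rewrite /normalized_indicator indicE memNset// !mulr0.
rewrite ler_wpM2r ?normalized_indicator_ge0// -sqrtr_sqr ler_sqrt// -sqrrN opprB.
by apply: (resistance_bound F0_fin hA dg) => //; exact: DB.
Qed.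

Lemma resolvent_oscillation K :
  \sum_(k < K) (inner mu (phi k) f - phi k x) ^+ 2 / (1 + lam k) <= e.
Proof.
apply: (@dual_sum_le _ K (fun k => inner mu (phi k) f - phi k x) (fun k => 1 + lam k) e); [exact: lam1_gt0|exact: e0|].
move=> c.
have -> : \sum_(k < K) c k * (inner mu (phi k) f - phi k x) =
   inner mu (eigensum K c) f - eigensum K c x.
  rewrite (inner_suml (index_enum 'I_K) (fun k => c k))//;
    [|by move=> ?; exact: eigenfun_L2|exact: normalized_indicator_L2].
  by rewrite -sumrB; apply: eq_bigr => k _; rewrite mulrBr.
apply: le_trans (average_oscillation (eigensum_dom _ _) (eigensum_L2 _ _)) _.
rewrite ler_wpM2l// energy_eigensum; apply: ler_sum => k _.
by rewrite ler_wpM2l ?sqr_ge0// lerDr.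
Qed.

(** Counterpart of [resolvent_oscillation]: there the energy is controlled by the [lam k] in the
    weight, here the L^2 norm is controlled by the [1]. *)
Lemma resolvent_average K :
  \sum_(k < K) inner mu (phi k) f ^+ 2 / (1 + lam k) <= inner mu f f.
Proof.
apply: (@dual_sum_le _ K (fun k => inner mu (phi k) f) (fun k => 1 + lam k)); [exact: lam1_gt0|exact: inner_ge0|].
move=> c; have fL := normalized_indicator_L2; have gL := eigensum_L2 K c.
have -> : \sum_(k < K) c k * inner mu (phi k) f = inner mu (eigensum K c) f.
  by rewrite (inner_suml (index_enum 'I_K) (fun k => c k))// => ?; exact: eigenfun_L2.
rewrite (le_trans (cauchy_schwarz gL fL))// mulrC ler_wpM2l ?inner_ge0//.
rewrite inner_eigensum_diag; apply: ler_sum => k _.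
by rewrite ler_peMr ?sqr_ge0// lerDl (eb_ge0 hphi).
Qed.

(** Uniformity in [K] is the point: it yields convergence of the mode series at [x]. *)
Lemma resolvent_diag K :
  \sum_(k < K) phi k x ^+ 2 / (1 + lam k) <= 2 * e + 2 * inner mu f f.
Proof.
apply: (@le_trans _ _ (2 * (\sum_(k < K) (inner mu (phi k) f - phi k x) ^+ 2 / (1 + lam k)) +
   2 * \sum_(k < K) inner mu (phi k) f ^+ 2 / (1 + lam k))); last first.
  by rewrite lerD// ler_wpM2l// ?resolvent_oscillation// resolvent_average.
rewrite !mulr_sumr -big_split/=; apply: ler_sum => k _.
rewrite !mulrA -mulrDl ler_wpM2r ?invr_ge0 ?(ltW (lam1_gt0 _))//.
(* With m the average and p the value at [x], 2 (m - p)^2 + 2 m^2 - p^2 = (2 m - p)^2. *)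
have := sqr_ge0 (2 * inner mu (phi k) f - phi k x); nra.
Qed.

End OnePoint.
End SpectralBounds.

(** * The damped oscillator *)

Section Oscillator.
Context {R : realType}.
Implicit Types v w : R -> R.

Lemma derivative_on_ge0_continuous v w : derivative_on_ge0 v w ->
  {within [set s : R | 0 <= s], continuous v}.
Proof.
move=> vw; apply/subspace_continuousP => t t0.
have q0 : (fun s => v t + (v s - v t) / (s - t) * (s - t)) @ within [set s | 0 <= s] t^' --> v t.
  rewrite -[X in _ --> X]addr0 -[X in _ --> _ + X](mulr0 (w t)).
  apply: cvgD; first exact: cvg_cst.
  apply: cvgM; first exact: vw.
  rewrite -[X in _ --> X](subrr t).
  apply: cvgB; last exact: cvg_cst.
  apply: cvg_trans (@nbhs_dnbhs _ t).
  exact: cvg_within.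
apply/cvgrPdist_lt => e e0.
move/cvgrPdist_lt: q0 => /(_ _ e0).
move=> q.
have {}q : nbhs t (fun s : R => s != t -> 0 <= s ->
    `|v t - (v t + (v s - v t) / (s - t) * (s - t))| < e) := q.
change (nbhs t (fun s : R => 0 <= s -> `|v t - v s| < e)).
apply: (filterS _ q) => s /= H s0.
(* The difference quotient controls only the punctured neighbourhood; continuity also asks for
   [s = t]. *)
have [->|st] := eqVneq s t; first by rewrite subrr normr0.
have := H st s0.
by rewrite divfK ?subr_eq0// addrCA subrr addr0.
Qed.

(** At an interior point of the half line all nearby points are nonnegative, so the one-sided limit
    is two-sided. *)
Lemma derivative_on_ge0_is_derive v w (t : R) : derivative_on_ge0 v w -> 0 < t ->
  is_derive t 1 v (w t).
Proof.
move=> vw t0.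
have H : (fun h : R => h^-1 *: (v (h *: 1 + t) - v t)) @ 0^' --> w t.
  have := vw t (ltW t0).
  move=> /cvgrPdist_lt q; apply/cvgrPdist_lt => e e0.
  have {}q : nbhs t (fun s : R => s != t -> 0 <= s ->
    `|w t - (v s - v t) / (s - t)| < e) := q _ e0.
  have sh : (fun h : R => h + t) @ nbhs (0 : R) --> nbhs t.
    rewrite -[X in _ --> nbhs X]add0r; apply: cvgD; [exact: cvg_id|exact: cvg_cst].
  have tp : nbhs t [set s : R | 0 < s] by exact: lt_nbhsr.
  change (nbhs (0 : R) (fun h => h != 0 -> `|w t - h^-1 *: (v (h *: 1 + t) - v t)| < e)).
  have A1 : nbhs (0 : R) (fun h => h + t != t -> 0 <= h + t ->
    `|w t - (v (h + t) - v t) / (h + t - t)| < e) := sh _ q.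
  have A2 : nbhs (0 : R) (fun h => 0 < h + t) := sh _ tp.
  apply: (filterS _ (filterI A1 A2)) => h [/= p1 p2] h0.
  have ht : h + t != t by rewrite -subr_eq0 addrK.
  have := p1 ht (ltW p2).
  by rewrite addrK [h *: 1]mulr1 mulrC.
by apply: DeriveDef; [apply/cvg_ex; exists (w t)|apply/cvg_lim].
Qed.

Section Decay.
Variables (beta lam : R) (v : R -> R).
Hypotheses (beta0 : 0 <= beta) (lam0 : 0 <= lam) (hv : damped_oscillator beta lam v).
Local Notation gam := (Num.sqrt (beta ^+ 2 + 1) - beta).

(** [gam] is the positive root of x^2 + 2 beta x = 1; in this form it makes the quadratic form of
    [oscillator_decay] nonnegative. *)
Lemma damping_rate_eq : gam ^+ 2 + 2 * beta * gam = 1.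
Proof.
have : Num.sqrt (beta ^+ 2 + 1) ^+ 2 = beta ^+ 2 + 1.
  by rewrite sqr_sqrtr// addr_ge0 ?sqr_ge0.
by move=> ?; nra.
Qed.

Lemma damping_rate_gt0 : 0 < gam.
Proof.
rewrite subr_gt0 -[ltLHS]ger0_norm// -sqrtr_sqr ltr_sqrt ?ltrDl//.
by rewrite ltr_wpDl ?sqr_ge0.
Qed.

Lemma oscillator_continuous : {within [set s : R | 0 <= s], continuous v}.
Proof. by case: hv => w [w' [vw _ _ _ _]]; exact: derivative_on_ge0_continuous vw. Qed.

(* [exp (- 2 gam s) (v'^2 + (lam + 1) v^2)] is nonincreasing: minus its
   derivative is [2 exp (- 2 gam s)] times
   [gam v^2 + (gam + 2 beta) v'^2 - v v' + gam lam v^2], a nonnegative quadratic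
   form because [gam (gam + 2 beta) = 1]. *)
Lemma oscillator_decay (t : R) : 0 <= t -> (1 + lam) * v t ^+ 2 <= expR (2 * gam * t).
Proof.
case: hv => w [z [vw wz eqn v0 w0]] t0.
have g0 := damping_rate_gt0; have gE := damping_rate_eq.
move: g0 gE; set g := gam => g0 gE.
have [->|tp] := eqVneq t 0; first by rewrite v0 expr0n/= mulr0 expR_ge0.
have {}tp : 0 < t by rewrite lt_neqAle eq_sym tp.
pose Q : R -> R := (expR \o ((-2 * g) *: id)) * (w ^+ 2 + (lam + 1) *: v ^+ 2).
have dQ (x : R) : 0 < x -> is_derive x 1 Q
    (- (2 * expR (- 2 * g * x) *
      (g * v x ^+ 2 + (g + 2 * beta) * w x ^+ 2 - v x * w x + g * lam * v x ^+ 2))).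
  move=> x0.
  have dv := derivative_on_ge0_is_derive vw x0.
  have dw := derivative_on_ge0_is_derive wz x0.
  have d1 : is_derive x 1 ((-2 * g) *: (@id R)) (-2 * g).
    by apply: is_derive_eq; rewrite /GRing.scale/= mulr1.
  have d2 := @is_derive1_comp R expR _ x _ _ (is_derive_expR _) d1.
  have d3 : is_derive x 1 (w ^+ 2) (2 * w x * z x).
    by apply: is_derive_eq; rewrite /GRing.scale/= expr1 mulr_natl.
  have d4 : is_derive x 1 (v ^+ 2) (2 * v x * w x).
    by apply: is_derive_eq; rewrite /GRing.scale/= expr1 mulr_natl.
  have d5 := is_deriveM d2 (is_deriveD d3 (is_deriveZ (lam + 1) d4)).
  apply: (is_derive_eq d5).
  have -> : z x = - (2 * beta * w x + lam * v x) by have := eqn x (ltW x0); lra.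
  have sc (c e : R) : c *: e = c * e by [].
  by rewrite !fctE /GRing.scale/= !sc; ring.
have cts (h k : R -> R) : derivative_on_ge0 h k -> {within `[0, t], continuous h}.
  move=> hk; apply: continuous_subspaceW (derivative_on_ge0_continuous hk).
  by move=> s /=; rewrite in_itv/= => /andP[].
have QE s : Q s = expR (- 2 * g * s) * (w s ^+ 2 + (lam + 1) * v s ^+ 2) by [].
clearbody Q.
have : Q t <= Q 0.
  apply: (@ler0_derive1_le_cc _ Q 0 t) => //; rewrite ?in_itv/= ?lexx ?ltW//.
  - by move=> x; rewrite in_itv/= => /andP[x0 _]; have [] := dQ x x0.
  - move=> x; rewrite in_itv/= => /andP[x0 _].
    have dQx := dQ x x0; rewrite derive1E derive_val oppr_le0.
    have gE' : g * (g + 2 * beta) = 1 by move: gE; lra.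
    apply: mulr_ge0; first by rewrite mulr_ge0 ?expR_ge0.
    apply: addr_ge0; last by apply: mulr_ge0; rewrite ?sqr_ge0// mulr_ge0// ltW.
    (* Multiplied by [g], and since [g (g + 2 beta) = 1], the form is (g v - w/2)^2 + (3/4) w^2. *)
    rewrite -(pmulr_rge0 _ g0).
    have -> : g * (g * v x ^+ 2 + (g + 2 * beta) * w x ^+ 2 - v x * w x) =
        g ^+ 2 * v x ^+ 2 + g * (g + 2 * beta) * w x ^+ 2 - g * v x * w x by ring.
    have := sqr_ge0 (g * v x - 2^-1 * w x); have := sqr_ge0 (w x).
    by rewrite gE'; nra.
  - have cv := cts _ _ vw; have cw := cts _ _ wz.
    move=> s; rewrite (_ : Q = fun s => expR (- 2 * g * s) * (w s ^+ 2 + (lam + 1) * v s ^+ 2)); last exact/funext.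
    apply: cvgM.
      apply: (continuous_subspaceT (A := `[0, t]%classic)) => y.
      apply: continuous_comp; last exact: continuous_expR.
      by apply: cvgMr; exact: cvg_id.
    apply: cvgD; first by apply: (cvgM (cw s) (cw s)).
    by apply: cvgMr; apply: (cvgM (cv s) (cv s)).
rewrite !QE v0 w0 mulr0 expR0 mul1r expr1n expr0n/= mulr0 addr0 => H.
have w2 : expR (-2 * g * t) * ((1 + lam) * v t ^+ 2) <= 1.
  apply: le_trans H; rewrite ler_wpM2l ?expR_ge0// (addrC 1) lerDr sqr_ge0//.
have E : expR (-2 * g * t) * expR (2 * g * t) = 1.
  by rewrite -expRD (_ : _ + _ = 0) ?expR0//; ring.
by rewrite -(ler_pM2l (expR_gt0 (-2 * g * t))) E.
Qed.

Lemma expR_integral (c t : R) : 0 < c -> 0 <= t ->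
  (\int[lebesgue_measure]_(s in `[0%R, t]) (expR (c * (t - s)))%:E <= (expR (c * t) / c)%:E)%E.
Proof.
move=> c0; rewrite le_eqVlt => /orP[/eqP <-|t0].
  by rewrite set_itv1 integral_set1 lee_fin divr_ge0 ?expR_ge0 ?ltW.
pose G : R -> R := (- c^-1) *: (expR \o (c *: (cst t - id))).
have dG (x : R) : is_derive x 1 G (expR (c * (t - x))).
  have d1 : is_derive x 1 (c *: (cst t - @id R)) (- c).
    by apply: is_derive_eq; rewrite sub0r /GRing.scale/= mulrN1.
  apply: (is_derive_eq (is_deriveZ (- c^-1) (@is_derive1_comp R expR _ x _ _ (is_derive_expR _) d1))).
  have sc (a e : R) : a *: e = a * e by [].
  rewrite sc !fctE/= sc; field; lra.
have cG : continuous G.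
  by move=> x; apply/differentiable_continuous/derivable1_diffP; have [] := dG x.
rewrite (@continuous_FTC2 _ _ G)//.
- rewrite -EFinB lee_fin /G !fctE/= subrr scaler0 expR0 subr0.
  have sc (a e : R) : a *: e = a * e by [].
  have ci : 0 < c^-1 by rewrite invr_gt0.
  by rewrite !sc mulr1 mulNr opprK [leRHS]mulrC; lra.
- apply: continuous_subspaceT => x.
  apply: continuous_comp; last exact: continuous_expR.
  by apply: cvgMr; apply: cvgB; [exact: cvg_cst|exact: cvg_id].
- split.
  + by move=> x _; have [] := dG x.
  + exact/cvg_at_right_filter/cG.
  + exact/cvg_at_left_filter/cG.
- by move=> x _; have dGx := dG x; rewrite derive1E derive_val.
Qed.

(** Continuity of [v] is known only on the half line, and [t - s] stays there exactly when [s <= t];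
    hence the restriction to [[0, t]]. *)
Lemma oscillator_reversed_measurable (t : R) :
  measurable_fun `[0, t] (fun s => v (t - s)).
Proof.
apply: subspace_continuous_measurable_fun => //.
apply/subspace_continuousP => s /=; rewrite in_itv/= => /andP[s0 st].
have /subspace_continuousP cv := oscillator_continuous.
have ts : 0 <= t - s by rewrite subr_ge0.
apply: cvg_comp (cv _ ts).
move=> A; rewrite /within/= !nearE => HA.
have cs : (fun s : R => t - s) @ nbhs s --> nbhs (t - s).
  by apply: cvgB; [exact: cvg_cst|exact: cvg_id].
have HA' : nbhs s (fun s => 0 <= t - s -> A (t - s)) := cs _ HA.
change (nbhs s (fun s : R => `[0, t]%classic s -> A (t - s))).
apply: (filterS _ HA') => y H /=; rewrite in_itv/= => /andP[y0 yt].
by apply: H; rewrite subr_ge0.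
Qed.

Lemma oscillator_sqr_integral (t : R) : 0 <= t ->
  (\int[lebesgue_measure]_(s in `[0%R, t]) (v (t - s) ^+ 2)%:E <=
   (expR (2 * gam * t) / (2 * gam * (1 + lam)))%:E)%E.
Proof.
move=> t0; have g0 := damping_rate_gt0.
have l0 : 0 < 1 + lam by rewrite ltr_pwDl.
have mexp : measurable_fun `[0, t] (fun s => (expR (2 * gam * (t - s)))%:E).
  apply/measurable_EFinP; apply: measurable_funTS.
  apply: measurableT_comp => //; apply: measurable_funM => //; exact: measurable_funB.
apply: (@le_trans _ _ (\int[lebesgue_measure]_(s in `[0%R, t])
    ((1 + lam)^-1%:E * (expR (2 * gam * (t - s)))%:E))%E).
  apply: ge0_le_integral => //.
  - by move=> s _; rewrite lee_fin sqr_ge0.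
  - by apply/measurable_EFinP; apply: measurable_funX; exact: oscillator_reversed_measurable.
  - exact: measurable_funeM.
  - move=> s /=; rewrite in_itv/= => /andP[s0 st].
    rewrite -EFinM lee_fin mulrC ler_pdivlMr// mulrC.
    by apply: oscillator_decay; rewrite subr_ge0.
rewrite ge0_integralZl//; last by rewrite lee_fin invr_ge0 ltW.
apply: (@le_trans _ _ ((1 + lam)^-1%:E * (expR (2 * gam * t) / (2 * gam))%:E)%E).
  rewrite lee_wpmul2l ?lee_fin ?invr_ge0 ?(ltW l0)//.
  by apply: expR_integral => //; rewrite mulr_gt0.
rewrite -EFinM lee_fin (invfM (2 * gam)).
by rewrite [leLHS]mulrC mulrA.
Qed.

End Decay.
End Oscillator.

(** * Mean square limits of Gaussian variables *)

Section NormalDensity.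
Context {R : realType}.
Local Notation cpeak := (normal_peak (1 : R)).

Lemma normal_peak1_le1 : cpeak <= 1.
Proof.
rewrite /normal_peak invf_le1 ?sqrtr_gt0.
  rewrite -[leLHS]sqrtr1 ler_sqrt expr1n mul1r; have := @pi_ge2 R; lra.
by rewrite expr1n mul1r; have := @pi_gt0 R; lra.
Qed.

Lemma normal_peak_scale (s : R) : 0 < s -> normal_peak s = s^-1 * cpeak.
Proof.
move=> s0; rewrite /normal_peak -mulrnAr sqrtrM ?sqr_ge0// sqrtr_sqr gtr0_norm// invfM.
by rewrite expr1n mul1r.
Qed.

Lemma normal_pdf_gt0E (s x : R) : 0 < s ->
  normal_pdf 0 s x = s^-1 * cpeak * expR (- x ^+ 2 / (2 * s ^+ 2)).
Proof.
move=> s0; rewrite normal_pdfE ?gt_eqF// normal_peak_scale//.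
by rewrite /normal_fun subr0 mulr_natl.
Qed.

(** An integrable majorant, uniform in [t], for dominated convergence. The 4 is the ratio of the
    largest peak, at deviation [s / 2], to the peak at [2 * s]. *)
Lemma normal_pdf_dom (s t x : R) : 0 < s -> s / 2 <= t <= 2 * s ->
  normal_pdf 0 t x <= 4 * normal_pdf 0 (2 * s) x.
Proof.
move=> s0 /andP[st ts].
have t0 : 0 < t by apply: lt_le_trans st; rewrite divr_gt0.
have s20 : 0 < 2 * s by rewrite mulr_gt0.
rewrite !normal_pdf_gt0E//.
have -> : 4 * ((2 * s)^-1 * cpeak * expR (- x ^+ 2 / (2 * (2 * s) ^+ 2))) =
  (s / 2)^-1 * cpeak * expR (- x ^+ 2 / (2 * (2 * s) ^+ 2)) by field; lra.
apply: ler_pM => //.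
- by rewrite mulr_ge0 ?normal_peak_ge0// invr_ge0 ltW.
- by rewrite ler_wpM2r ?normal_peak_ge0// lef_pV2 ?posrE// divr_gt0.
rewrite ler_expR !mulNr lerN2 ler_wpM2l ?sqr_ge0// lef_pV2 ?posrE ?mulr_gt0 ?exprn_gt0//.
by rewrite ler_wpM2l// lerXn2r ?nnegrE ?(ltW t0) ?(ltW s20).
Qed.

(** Comparison with one fixed probability density turns the tail mass into a multiple of [s] without
    computing an integral. *)
Lemma normal_pdf_tail (s e x : R) : 0 < s -> s <= 1 -> 0 < e -> e <= `|x| ->
  normal_pdf 0 s x <= 8 * s / e ^+ 2 * normal_pdf 0 2 x.
Proof.
move=> s0 s1 e0 ex; rewrite !normal_pdf_gt0E//.
have e2x : e ^+ 2 <= x ^+ 2.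
  by rewrite -[leRHS]real_normK ?num_real// lerXn2r ?nnegrE ?(ltW e0).
have e20 : 0 < e ^+ 2 by rewrite exprn_gt0.
have s20 : 0 < s ^+ 2 by rewrite exprn_gt0.
have s21 : s ^+ 2 <= 1 by rewrite expr_le1// ltW.
(* Half of the Gaussian exponent. One half dominates the exponent of the density of deviation 2, the
   other gives smallness through [expR (- y) <= y^-1]. *)
pose y := x ^+ 2 / (4 * s ^+ 2).
have x20 : 0 < x ^+ 2 := lt_le_trans e20 e2x.
have y0 : 0 < y by rewrite divr_gt0// mulr_gt0.
have H1 : expR (- x ^+ 2 / (2 * s ^+ 2)) <= expR (- x ^+ 2 / (2 * 2 ^+ 2)) * expR (- y).
  rewrite -expRD ler_expR !mulNr -opprD lerN2.
  have -> : x ^+ 2 / (2 * s ^+ 2) = y + y by rewrite /y; field; lra.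
  rewrite lerD2r /y ler_wpM2l ?sqr_ge0// lef_pV2 ?posrE ?mulr_gt0//; lra.
have H2 : expR (- y) <= 4 * s ^+ 2 / e ^+ 2.
  rewrite expRN; apply: (@le_trans _ _ y^-1).
    rewrite lef_pV2 ?posrE ?expR_gt0//; apply: le_trans (expR_ge1Dx y); lra.
  by rewrite /y invf_div ler_wpM2l ?lef_pV2 ?posrE // mulr_ge0// ltW.
have c0 := normal_peak_ge0 (1 : R).
apply: (@le_trans _ _ (s^-1 * cpeak * (expR (- x ^+ 2 / (2 * 2 ^+ 2)) * (4 * s ^+ 2 / e ^+ 2)))).
  rewrite ler_wpM2l ?mulr_ge0 ?invr_ge0 ?(ltW s0)// (le_trans H1)// ler_wpM2l ?expR_ge0//.
rewrite le_eqVlt; apply/orP; left; apply/eqP; field; lra.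
Qed.

Lemma measurable_EFin_normal_pdf (s : R) (A : set R) :
  measurable_fun A (fun x : R => (normal_pdf 0 s x)%:E).
Proof.
apply/measurable_EFinP; apply: (@measurable_funS _ _ _ _ setT) => //.
exact: measurable_normal_pdf.
Qed.

Lemma normal_prob_cvg (s : R) (t : nat -> R) (A : set R) : 0 < s -> measurable A ->
  (forall n, s / 2 <= t n <= 2 * s) -> t n @[n --> \oo] --> s ->
  (fun n => normal_prob 0 (t n) A) @ \oo --> normal_prob 0 s A.
Proof.
move=> s0 mA st ts.
have tp n : 0 < t n by case/andP: (st n) => + _; apply: lt_le_trans; rewrite divr_gt0.
rewrite /normal_prob.
have := @dominated_convergence _ _ R lebesgue_measure A mA
  (fun n x => (normal_pdf 0 (t n) x)%:E) (fun x => (normal_pdf 0 s x)%:E)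
  (fun x => (4%:E * (normal_pdf 0 (2 * s) x)%:E)%E).
case => //.
- by move=> n; exact: measurable_EFin_normal_pdf.
- exact: measurable_EFin_normal_pdf.
- apply/nearW => x _; apply: cvg_EFin; first exact: nearW.
  rewrite /comp/= normal_pdf_gt0E//; under eq_fun do rewrite normal_pdf_gt0E//.
  apply: cvgM; first by apply: cvgMl; apply: cvgV => //; rewrite gt_eqF.
  apply: (cvg_comp _ expR); last exact: continuous_expR.
  apply: cvgMr; apply: cvgV; first by rewrite gt_eqF// mulr_gt0// exprn_gt0.
  by apply: cvgMr; apply: cvgM.
- apply: integrableZl => //; apply: integrableS (integrable_normal_pdf 0 (2 * s)) => //.
- apply/nearW => x n _; rewrite gee0_abs ?lee_fin ?normal_pdf_ge0//.
  exact: normal_pdf_dom.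
Qed.

Lemma normal_prob_tail (s e : R) : 0 < s -> s <= 1 -> 0 < e ->
  (normal_prob 0 s [set x | e <= `|x|]%R <= (8 * s / e ^+ 2)%:E)%E.
Proof.
move=> s0 s1 e0.
have mA : measurable [set x : R | e <= `|x|].
  rewrite (_ : mkset _ = (fun x : R => `|x|) @^-1` `[e, +oo[%classic); last first.
    by apply/seteqP; split => x /=; rewrite in_itv/= andbT.
  by rewrite -[X in measurable X]setTI; exact: normr_measurable.
have c0 : 0 <= 8 * s / e ^+ 2 by rewrite divr_ge0 ?sqr_ge0// mulr_ge0// ltW.
apply: (@le_trans _ _ (\int[lebesgue_measure]_(x in [set x | e <= `|x|]%R)
    ((8 * s / e ^+ 2)%:E * (normal_pdf 0 2 x)%:E))%E).
  apply: ge0_le_integral => //.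
  - by move=> x _; rewrite lee_fin normal_pdf_ge0.
  - exact: measurable_EFin_normal_pdf.
  - by apply: measurable_funeM; exact: measurable_EFin_normal_pdf.
  - by move=> x /= ex; rewrite -EFinM lee_fin normal_pdf_tail.
rewrite ge0_integralZl ?lee_fin//; last 2 first.
- exact: measurable_EFin_normal_pdf.
- by move=> x _; rewrite lee_fin normal_pdf_ge0.
rewrite -[leRHS]mule1 lee_wpmul2l ?lee_fin//.
exact: (@probability_le1 _ _ _ (normal_prob 0 2)).
Qed.

Lemma normal_prob_bounded_le (s : R) (A : set R) : 0 < s -> measurable A ->
  (normal_prob 0 s A <= (s^-1)%:E * lebesgue_measure A)%E.
Proof.
move=> s0 mA; rewrite -integral_cst//.
apply: ge0_le_integral => //.
- by move=> x _; rewrite lee_fin normal_pdf_ge0.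
- exact: measurable_EFin_normal_pdf.
move=> x _; rewrite lee_fin (le_trans (normal_pdf_ub _ _ _)) ?gt_eqF//.
by rewrite normal_peak_scale// ler_piMr ?invr_ge0 ?(ltW s0)// normal_peak1_le1.
Qed.

End NormalDensity.
(** The indices [m k] may repeat; [k <= m k] is what [cvg_subsequence] asks for. *)
Lemma cluster_subsequence {R : realType} (u : nat -> R) (l : R) (e : nat -> R) :
  cluster (u @ \oo) l -> (forall k, 0 < e k) ->
  exists m : nat -> nat, forall k, (k <= m k)%N /\ `|l - u (m k)| < e k.
Proof.
move=> cl e0.
have H k : exists n, (k <= n)%N /\ `|l - u n| < e k.
  have A : (u @ \oo) (u @` [set n | (k <= n)%N]).
    by exists k => // n /= kn; exists n.
  have [_ [[n /= kn <-] B]] := cl _ _ A (nbhsx_ballx l (e k) (e0 k)).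
  by exists n.
by have [m Hm] := choice H; exists m.
Qed.

Lemma cvg_ge_cst {R : realType} (u : nat -> R) (l x : R) :
  u n @[n --> \oo] --> l -> (forall n, x <= u n) -> x <= l.
Proof.
move=> ul xu; rewrite -(cvg_lim _ ul)//; apply: limr_ge; first exact: cvgP ul.
exact: nearW.
Qed.

Lemma cvg_le_cst {R : realType} (u : nat -> R) (l x : R) :
  u n @[n --> \oo] --> l -> (forall n, u n <= x) -> l <= x.
Proof.
move=> ul xu; rewrite -(cvg_lim _ ul)//; apply: limr_le; first exact: cvgP ul.
exact: nearW.
Qed.

Lemma cvg_subsequence {R : realType} (u : nat -> R) (l : R) (m : nat -> nat) :
  (forall k, (k <= m k)%N) -> u n @[n --> \oo] --> l -> u (m k) @[k --> \oo] --> l.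
Proof.
move=> mk; apply: cvg_comp => A [N _ NA]; exists N => // n /= Nn; apply: NA => /=.
exact: leq_trans (mk n).
Qed.

Lemma cvg_harmonic_rate {R : realType} (c : R) :
  c / (2 * k.+1%:R) @[k --> \oo] --> 0.
Proof.
rewrite (_ : (fun k => _) = fun k => (c / 2) * harmonic k).
  by rewrite -[X in _ --> X](mulr0 (c / 2)); apply: cvgMr; exact: cvg_harmonic.
by apply/funext => k; rewrite /harmonic invfM mulrA.
Qed.

Lemma fine_measure_le_U {R : realType} {d : measure_display} {T : measurableType d}
    (Q : probability T R) (A B C : set T) :
  measurable A -> measurable B -> measurable C -> A `<=` B `|` C ->
  fine (Q A) <= fine (Q B) + fine (Q C).
Proof.
move=> mA mB mC ABC.
have f X : measurable X -> (fine (Q X))%:E = Q X by move=> mX; rewrite fineK// fin_num_measure.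
rewrite -lee_fin EFinD !f//.
apply: (@le_trans _ _ (Q (B `|` C))); last exact: measureU2.
by apply: le_measure; rewrite ?inE//; exact: measurableU.
Qed.

Section GaussianLimit.
Context {R : realType} {d : measure_display} {Om : measurableType d}.
Variable P : probability Om R.
Local Notation pr A := (fine (P A)).
Local Notation np s A := (fine (normal_prob 0 s A)).

Lemma measurable_normge (e : R) : measurable [set x : R | e <= `|x|].
Proof.
rewrite (_ : mkset _ = (fun x : R => `|x|) @^-1` `[e, +oo[%classic); last first.
  by apply/seteqP; split => x /=; rewrite in_itv/= andbT.
by rewrite -[X in measurable X]setTI; exact: normr_measurable.
Qed.

Lemma measurable_preimage (Y : Om -> R) (A : set R) :
  measurable_fun setT Y -> measurable A -> measurable (Y @^-1` A).
Proof. by move=> mY mA; rewrite -[X in measurable X]setTI; exact: mY. Qed.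

Lemma sqr_markov (X : Om -> R) (e : R) : measurable_fun [set: Om] X -> 0 < e ->
  (P [set o | (e <= `|X o|)%R] <= ((e ^+ 2)^-1)%:E * \int[P]_o (X o ^+ 2)%:E)%E.
Proof.
move=> mX e0.
have mA := measurable_preimage mX (measurable_normge e).
have e20 : 0 < e ^+ 2 by rewrite exprn_gt0.
have mI : measurable_fun [set: Om] (fun x => \1_[set o | e <= `|X o|] x : R).
  exact: measurable_indic mA.
rewrite -ge0_integralZl//; last 3 first.
- by apply/measurable_EFinP; exact: measurable_funX.
- by move=> x _; rewrite lee_fin sqr_ge0.
- by rewrite lee_fin invr_ge0 ltW.
rewrite -[X in P X]setIT -integral_indic//.
apply: ge0_le_integral => //.
- exact/measurable_EFinP.
- by apply: measurable_funeM; apply/measurable_EFinP; exact: measurable_funX.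
move=> x _; rewrite -EFinM lee_fin indicE.
case: (boolP (x \in _)) => [|_]; last by rewrite mulr_ge0 ?sqr_ge0// invr_ge0 ltW.
rewrite inE/= => ex; rewrite ler_pdivlMl// mulr1 -[leRHS]real_normK ?num_real//.
by rewrite lerXn2r ?nnegrE// ltW.
Qed.

Lemma normal_prob_itv_le (s a b : R) : 0 < s -> a <= b -> np s `]a, b]%classic <= s^-1 * (b - a).
Proof.
move=> s0 ab.
have := @normal_prob_bounded_le R s `]a, b]%classic s0.
rewrite lebesgue_measure_itv/= lte_fin.
case: ifPn => [_|ba]; rewrite -?EFinB -?EFinM => /(_ (measurable_itv _)) H.
  by rewrite -lee_fin fineK// fin_num_measure.
have -> : a = b by apply/eqP; rewrite eq_le ab leNgt.
rewrite set_itvoc0 /normal_prob integral_set0 subrr mulr0//.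
Qed.

(** The density is at most [s^-1], so moving the endpoint by [e] changes the mass by at most
    [s^-1 * e]. *)
Lemma normal_prob_ray (s a e : R) : 0 < s -> 0 <= e ->
  np s `]a - e, +oo[%classic <= np s `]a, +oo[%classic + s^-1 * e.
Proof.
move=> s0 e0.
have H : a - e <= a by lra.
apply: (le_trans (@fine_measure_le_U _ _ _ (normal_prob 0 s) _ `]a, +oo[%classic `]a - e, a]%classic _ _ _ _)) => //.
  move=> x /=; rewrite !in_itv/= !andbT => xa.
  by have [?|?] := ltP a x; [left|right; rewrite xa].
by rewrite lerD2l (le_trans (normal_prob_itv_le s0 H))// opprB addrC subrK.
Qed.

Variables (X_ : nat -> Om -> R) (X : Om -> R).
Hypothesis mX_ : forall n, measurable_fun [set: Om] (X_ n).
Hypothesis mX : measurable_fun [set: Om] X.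

Let dev (e : R) n := pr [set o | e <= `|X_ n o - X o|].

(** Transfers events between [X] and [X_ n], in either direction: outside the deviation event they
    differ by less than [e]. *)
Let le_dev (A : set Om) n (B : set Om) (e : R) : measurable A -> measurable B ->
  A `<=` B `|` [set o | e <= `|X_ n o - X o|] -> pr A <= pr B + dev e n.
Proof.
move=> mA mB AB; apply: fine_measure_le_U => //.
by apply: (measurable_preimage _ (measurable_normge e)); exact: measurable_funB.
Qed.

Hypothesis dev0 : forall e : R, 0 < e -> dev e n @[n --> \oo] --> 0.

Variable s : nat -> R.
Hypothesis s0 : forall n, 0 <= s n.
Hypothesis law : forall n (A : set R), measurable A ->
  P (X_ n @^-1` A) = if s n == 0 then \d_(0 : R) A else normal_prob 0 (s n) A.

(** Some []- K, K]] has mass above 1/2 under the law of [X], hence []- (K + 1), K + 1]] has mass at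
    least 1/4 under that of [X_ n] for large [n]. A normal law gives it at most [2 (K + 1) / s n],
    whence the bound [8 (K + 1)]. *)
Lemma sd_bounded : exists S : R, \forall n \near \oo, s n <= S.
Proof.
have [K [K0 PK]] : exists K : R, 0 < K /\ 2^-1 < pr (X @^-1` `]- K, K]%classic).
  have H : P (X @^-1` `]- (n.+1%:R : R), n.+1%:R]%classic) @[n --> \oo] -->
      P (\bigcup_n X @^-1` `]- (n.+1%:R : R), n.+1%:R]%classic).
    apply: nondecreasing_cvg_mu.
    - by move=> n; exact: measurable_preimage.
    - by apply: bigcup_measurable => n _; exact: measurable_preimage.
    - move=> n m nm; apply/subsetPset; apply: preimage_subset; apply: subset_itv; rewrite bnd_simp.
        by rewrite lerN2 ler_nat.
      by rewrite ler_nat.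
  have E : \bigcup_n X @^-1` `]- (n.+1%:R : R), n.+1%:R]%classic = [set: Om].
    apply/seteqP; split => // o _; exists (Num.truncn `|X o|) => //=.
    have := truncnS_gt `|X o|; rewrite in_itv/= ltr_norml => /andP[-> /ltW ->]//.
  move: H; rewrite E.
  have -> : P [set: Om] = 1%:E by exact: probability_setT.
  move/fine_cvg => H.
  have h1 : 2^-1 < 1 :> R by lra.
  have [N _ HN] := cvgr_gt _ H _ h1.
  by exists N.+1%:R; split => //; apply: HN => /=.
exists (8 * (K + 1)).
have d1 := dev0 (ltr01 : 0 < (1 : R)).
have q1 : 0 < 4^-1 :> R by lra.
have {}d1 : \forall n \near \oo, dev 1 n < 4^-1 by exact: (cvgr_lt _ d1 _ q1).
apply: filterS d1 => n dn.
have [->|sn0] := eqVneq (s n) 0; first by rewrite mulr_ge0// addr_ge0// ltW.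
have sp : 0 < s n by rewrite lt_neqAle eq_sym sn0 s0.
have : pr (X @^-1` `]- K, K]%classic) <= pr (X_ n @^-1` `](- (K + 1)), K + 1]%classic) + dev 1 n.
  apply: le_dev; [exact: measurable_preimage|exact: measurable_preimage|].
  move=> o /=; rewrite !in_itv/= => /andP[p1 p2].
  case: (leP (1 : R) `|X_ n o - X o|) => [? |H]; [by right|left].
  by move: H; rewrite ltr_norml => /andP[? ?]; apply/andP; split; lra.
rewrite law// (negbTE sn0).
have KK : - (K + 1) <= K + 1 by lra.
have := normal_prob_itv_le sp KK => H1 H2.
have : 4^-1 <= (s n)^-1 * (K + 1 - - (K + 1)) by lra.
rewrite mulrC ler_pdivlMr// => H3; lra.
Qed.

(* Any cluster point of the standard deviations determines the law of the limit. *)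
Lemma limit_gt0 (l : R) : cluster (s n @[n --> \oo]) l -> 0 < l ->
  forall A : set R, measurable A -> P (X @^-1` A) = normal_prob 0 l A.
Proof.
move=> cl l0.
(* These tolerances tend to 0 and never exceed [l / 2], which keeps [s (m k)] in the window where
   [normal_prob_cvg] has its majorant. *)
have e0 k : 0 < l / (2 * k.+1%:R) by rewrite divr_gt0// mulr_gt0.
have [m Hm] := cluster_subsequence cl e0.
have mk k : (k <= m k)%N by case: (Hm k).
have inv_le k : l / (2 * k.+1%:R) <= l / 2.
  by rewrite ler_wpM2l ?(ltW l0)// lef_pV2 ?posrE ?mulr_gt0// ler_peMr// ler1n.
have sm k : l / 2 <= s (m k) <= 2 * l.
  move: (inv_le k) (Hm k).2; set c := l / (2 * k.+1%:R) => h1.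
  by rewrite ltr_norml => /andP[h2 h3]; apply/andP; split; lra.
have sm0 k : s (m k) != 0.
  by have /andP[] := sm k => H _; rewrite gt_eqF// (lt_le_trans _ H)// divr_gt0.
have cm : s (m k) @[k --> \oo] --> l.
  apply/cvgrPdist_lt => e ep.
  have H : \forall k \near \oo, l / (2 * k.+1%:R) < e by exact: (cvgr_lt _ (cvg_harmonic_rate l) _ ep).
  by apply: filterS H => k; apply: lt_trans; case: (Hm k).
have ncvg A : measurable A -> np (s (m k)) A @[k --> \oo] --> np l A.
  move=> mA; apply: fine_cvg; rewrite fineK ?fin_num_measure//.
  exact: normal_prob_cvg.
have dcvg e : 0 < e -> dev e (m k) @[k --> \oo] --> 0.
  by move=> ep; apply: (cvg_subsequence mk); exact: dev0.
have ray (a : R) : pr (X @^-1` `]a, +oo[%classic) = np l `]a, +oo[%classic.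
  (* Moving the endpoint by [l * e] absorbs the deviation of [X_ (m k)] from [X] and costs at most
     [e] of Gaussian mass. Both inequalities hold up to a deviation probability that vanishes as [k]
     grows. *)
  apply/eqP; rewrite eq_le; apply/andP; split; apply/ler_addgt0Pr => e ep.
    have le0 : 0 < l * e by rewrite mulr_gt0.
    apply: (@le_trans _ _ (np l `]a - l * e, +oo[%classic)); last first.
      by have := normal_prob_ray a l0 (ltW le0); rewrite mulKf// gt_eqF.
    rewrite -[leRHS]addr0; apply: cvg_ge_cst.
      by apply: cvgD; [exact: ncvg|exact: (dcvg _ le0)].
    move=> k /=; have := law (m k) (measurable_itv `]a - l * e, +oo[).
    rewrite (negbTE (sm0 k)) => <-; apply: le_dev; [exact: measurable_preimage|exact: measurable_preimage|].
    move=> o /=; rewrite !in_itv/= !andbT => o1.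
    case: (leP (l * e) `|X_ (m k) o - X o|) => [? |H]; [by right|left].
    by move: H; rewrite ltr_norml => /andP[? ?]; lra.
  have le0 : 0 < l * e by rewrite mulr_gt0.
  apply: (@le_trans _ _ (np l `]a + l * e, +oo[%classic + e)).
    by have := normal_prob_ray (a + l * e) l0 (ltW le0); rewrite addrK mulKf// gt_eqF.
  rewrite lerD2r -[leLHS]subr0; apply: cvg_le_cst.
    by apply: cvgB; [exact: ncvg|exact: (dcvg _ le0)].
  move=> k /=; have := law (m k) (measurable_itv `]a + l * e, +oo[).
  rewrite (negbTE (sm0 k)) => <-; rewrite lerBlDr.
  apply: le_dev; [exact: measurable_preimage|exact: measurable_preimage|].
  move=> o /=; rewrite !in_itv/= !andbT => o1.
  case: (leP (l * e) `|X_ (m k) o - X o|) => [? |H]; [by right|left].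
  by move: H; rewrite ltr_norml => /andP[? ?]; lra.
move=> A mA.
pose X' : {mfun Om >-> measurableTypeR R} :=
  mfun_Sub (mem_set mX : (X : Om -> measurableTypeR R) \in mfun).
pose m2 : measure (measurableTypeR R) R := normal_prob 0 l.
have -> : P (X @^-1` A) = distribution P X' A by [].
(* Open rays are stable under intersection and generate the Borel sets, so agreement on rays
   suffices. *)
apply: (@measure_unique _ R (measurableTypeR R) (RGenOInfty.G (R:=R))
  (fun n => `](- (n%:R : R)), +oo[%classic) _ _ _ _ (distribution P X') m2 _ _ A mA).
- exact: RGenOInfty.measurableE.
- move=> _ _ [x ->] [y ->]; exists (Num.max x y).
  by apply/seteqP; split => z /=; rewrite !in_itv/= !andbT gt_max => /andP.
- by move=> n; exists (- n%:R).
- apply/seteqP; split => // x _; exists (Num.truncn `|x|).+1 => //=.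
  by have := truncnS_gt `|x|; rewrite in_itv/= ltr_norml andbT => /andP[].
- move=> _ [x ->]; change (P (X @^-1` `]x, +oo[%classic) = normal_prob 0 l `]x, +oo[%classic).
  rewrite -[RHS]fineK ?fin_num_measure// -ray fineK//.
  by rewrite fin_num_measure//; exact: measurable_preimage.
- by move=> k; rewrite (le_lt_trans (probability_le1 _ _)) ?ltry//; exact: measurable_preimage.
Qed.

(** Along a subsequence the laws concentrate at 0, which forces [X = 0] almost surely. *)
Lemma limit_eq0 : cluster (s n @[n --> \oo]) 0 ->
  forall A : set R, measurable A -> P (X @^-1` A) = \d_(0 : R) A.
Proof.
move=> cl.
have e0 k : 0 < 1 / (2 * k.+1%:R) :> R by rewrite divr_gt0// mulr_gt0.
have [m Hm] := cluster_subsequence cl e0.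
have mk k : (k <= m k)%N by case: (Hm k).
have sm k : s (m k) < 1 / (2 * k.+1%:R).
  by have [_] := Hm k; rewrite sub0r normrN ger0_norm.
have sm1 k : s (m k) <= 1.
  rewrite (le_trans (ltW (sm k)))// ler_pdivrMr ?mulr_gt0// !mul1r -natrM ler1n//.
(* If [X] exceeds [2 * e] in modulus, then [X_ (m k)] or its deviation from [X] reaches [e]. Both
   probabilities vanish in the limit, the first by the Gaussian tail or, when [s (m k) = 0], because
   the law is a point mass at 0. *)
have tail e : 0 < e -> pr [set o | 2 * e <= `|X o|] = 0.
  move=> ep; apply/eqP; rewrite eq_le fine_ge0// andbT.
  have c1 : 8 * s (m k) / e ^+ 2 + dev e (m k) @[k --> \oo] --> 8 * 0 / e ^+ 2 + 0.
    apply: cvgD; last exact: (cvg_subsequence mk (dev0 ep)).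
    apply: cvgMl; apply: cvgMr; apply/cvgrPdist_lt => e' ep'.
    have H : \forall k \near \oo, 1 / (2 * k.+1%:R) < e' by exact: (cvgr_lt _ (cvg_harmonic_rate 1) _ ep').
    by apply: filterS H => k; apply: lt_trans; case: (Hm k).
  rewrite -[leRHS]addr0 -[X in X + _](mul0r (e ^+ 2)^-1) -[X in X / _ + _](mulr0 8).
  apply: (cvg_ge_cst c1) => k.
  apply: (@le_trans _ _ (pr (X_ (m k) @^-1` [set x | e <= `|x|]) + dev e (m k))).
    apply: le_dev.
    - exact: (measurable_preimage mX (measurable_normge _)).
    - exact: (measurable_preimage _ (measurable_normge _)).
    move=> o /= eo; case: (leP e `|X_ (m k) o - X o|) => [? |H]; [by right|left].
    have := ler_normD (X_ (m k) o) (- (X_ (m k) o - X o)).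
    by rewrite normrN opprB addrC subrK; lra.
  rewrite lerD2r law; last exact: measurable_normge.
  case: ifPn => [/eqP ->|sn0].
    by rewrite mulr0 mul0r diracE memNset//= normr0; apply/negP; rewrite -ltNge.
  have sp : 0 < s (m k) by rewrite lt_neqAle eq_sym sn0 s0.
  rewrite -lee_fin fineK ?fin_num_measure//; last exact: measurable_normge.
  exact: normal_prob_tail.
have mX0 : measurable [set o | X o != 0].
  rewrite (_ : mkset _ = X @^-1` (~` [set 0])).
    by apply: measurable_preimage => //; exact: measurableC.
  by apply/seteqP; split => o /= /eqP.
have X0 : P [set o | X o != 0] = 0%E.
  apply/(negligibleP _ mX0).
  apply: (@negligibleS _ _ _ _ (\bigcup_j [set o | 2 * j.+1%:R^-1 <= `|X o|])).
    move=> o /= Xo; have Xp : 0 < `|X o| / 2 by rewrite divr_gt0// normr_gt0.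
    have [n Hn] := ltr_add_invr Xp; exists n => //=.
    by move: Hn; rewrite add0r ltr_pdivlMr// mulrC => /ltW.
  apply: negligible_bigcup => j; apply/negligibleP.
    exact: (measurable_preimage mX (measurable_normge _)).
  rewrite -[LHS]fineK ?tail// ?invr_gt0// fin_num_measure//.
  exact: (measurable_preimage mX (measurable_normge _)).
have null (B : set R) : measurable B -> ~ B 0 -> P (X @^-1` B) = 0%E.
  move=> mB B0; apply/eqP; rewrite eq_le measure_ge0 andbT -X0.
  apply: le_measure; rewrite ?inE//; first exact: measurable_preimage.
  by move=> o /= BX; apply: contra_notN B0 => /eqP <-.
move=> A mA; rewrite diracE; have [A0|A0] := pselect (A 0); last by rewrite memNset// null.
rewrite mem_set//; have mC := measurable_preimage mX (measurableC mA).
have := probability_setC P mC; rewrite (null (~` A)); last 2 first.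
- exact: measurableC.
- by move=> /(_ A0).
by rewrite sube0 preimage_setC setCK.
Qed.

End GaussianLimit.

Lemma gaussian_limit {R : realType} {d : measure_display} {Om : measurableType d}
    (P : probability Om R) (X_ : nat -> Om -> R) (X : Om -> R) :
  (forall n, centred_gaussian P (X_ n)) -> measurable_fun [set: Om] X ->
  cvg_L2 P X_ X -> centred_gaussian P X.
Proof.
move=> gX mX XX; split=> //.
have mX_ n : measurable_fun [set: Om] (X_ n) by case: (gX n).
have [s Hs] := choice (fun n => let: conj _ (ex_intro2 s s0 H) := gX n in
  ex_intro (fun s => 0 <= s /\ forall A : set R, measurable A ->
    P (X_ n @^-1` A) = if s == 0 then \d_(0 : R) A else normal_prob 0 s A) s (conj s0 H)).
have s0 n : 0 <= s n by case: (Hs n).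
have law n (A : set R) : measurable A ->
  P (X_ n @^-1` A) = if s n == 0 then \d_(0 : R) A else normal_prob 0 (s n) A.
  by case: (Hs n) => _; apply.
have dev0 (e : R) : 0 < e -> fine (P [set o | e <= `|X_ n o - X o|]) @[n --> \oo] --> 0.
  move=> e0; apply: fine_cvg.
  have mD n : measurable_fun [set: Om] (fun o => X_ n o - X o) by exact: measurable_funB.
  have c : (((e ^+ 2)^-1)%:E * 'E_P[(fun o => (X_ n o - X o) ^+ 2)%R])%E @[n --> \oo] --> (((e ^+ 2)^-1)%:E * 0)%E.
    exact: cvgeZl.
  rewrite mule0 in c.
  apply: (squeeze_cvge _ (cvg_cst 0%E) c).
  by apply: nearW => n; rewrite measure_ge0/= unlock; exact: sqr_markov.
have [S HS] := sd_bounded mX_ mX dev0 s0 law.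
(* Compactness supplies a candidate for the standard deviation of the limit. *)
have [l [/= + cl]] : `[0, S]%classic `&` cluster (s n @[n --> \oo]) !=set0.
  apply: segment_compact; apply: filterS HS => n snS /=.
  by rewrite in_itv/= s0.
rewrite in_itv/= => /andP[l0 _]; exists l => // A mA.
case: eqVneq => [l00|ln0].
  by apply: (limit_eq0 mX_ mX dev0 s0 law) => //; rewrite -l00.
by apply: (limit_gt0 mX_ mX dev0 law cl) => //; rewrite lt_neqAle eq_sym ln0.
Qed.

(** * Completeness of [L^2] *)

Section ErealLimits.
Context {R : realType}.
Local Open Scope ereal_scope.
Implicit Types u : nat -> \bar R.

Lemma cvge0_near_le u (e : R) : u n @[n --> \oo] --> 0 -> (0 < e)%R ->
  \forall n \near \oo, u n <= e%:E.
Proof.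
move=> u0 e0; have e0' : 0 < e%:E by rewrite lte_fin.
have H : \forall n \near \oo, u n < e%:E := u0 _ (open_ereal_lt' e0').
by apply: filterS H => n /ltW.
Qed.

Lemma near_le_cvge0 u : (forall n, 0 <= u n) ->
  (forall e : R, (0 < e)%R -> \forall n \near \oo, u n <= e%:E) -> u n @[n --> \oo] --> 0.
Proof.
move=> u0 ue; apply: limn_esup_le_cvg => //.
apply/lee_addgt0Pr => e e0; rewrite add0e limn_esup_lim.
apply: lime_le; first exact: is_cvg_esups.
have [N _ HN] := ue e e0; exists N => // n /= Nn.
apply: ge_ereal_sup => _ [k /= nk <-]; apply: HN => /=; exact: leq_trans Nn nk.
Qed.

Lemma limn_einf_near_le u c : (\forall n \near \oo, u n <= c) -> limn_einf u <= c.
Proof.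
move=> [N _ HN]; rewrite limn_einf_lim; apply: lime_le; first exact: is_cvg_einfs.
apply: nearW => n; apply: (@le_trans _ _ (u (maxn n N))).
  by apply: ereal_inf_lbound; exists (maxn n N) => //=; exact: leq_maxl.
by apply: HN => /=; exact: leq_maxr.
Qed.

End ErealLimits.

Section SquareIntegral.
Context {d} {T : measurableType d} {R : realType}.
Variable mu : {measure set T -> \bar R}.
Local Open Scope ereal_scope.

Lemma sqr_integralD_le (D : set T) (f g : T -> R) : measurable D ->
  measurable_fun D f -> measurable_fun D g ->
  \int[mu]_(x in D) ((f x + g x) ^+ 2)%:E <=
  2%:E * \int[mu]_(x in D) (f x ^+ 2)%:E + 2%:E * \int[mu]_(x in D) (g x ^+ 2)%:E.
Proof.
move=> mD mf mg.
have m2 (h : T -> R) : measurable_fun D h -> measurable_fun D (fun x => (h x ^+ 2)%:E).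
  by move=> mh; apply/measurable_EFinP; exact: measurable_funX.
have i2 (h : T -> R) : measurable_fun D h -> 2%:E * \int[mu]_(x in D) (h x ^+ 2)%:E =
    \int[mu]_(x in D) (2%:E * (h x ^+ 2)%:E).
  move=> mh; rewrite ge0_integralZl//; first exact: m2.
  by move=> x _; rewrite lee_fin sqr_ge0.
rewrite !i2// -ge0_integralD//; last 4 first.
- by move=> x _; rewrite -EFinM lee_fin mulr_ge0 ?sqr_ge0.
- by apply: measurable_funeM; exact: m2.
- by move=> x _; rewrite -EFinM lee_fin mulr_ge0 ?sqr_ge0.
- by apply: measurable_funeM; exact: m2.
apply: ge0_le_integral => //.
- by move=> x _; rewrite lee_fin sqr_ge0.
- by apply: m2; exact: measurable_funD.
- by apply: emeasurable_funD; apply: measurable_funeM; exact: m2.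
move=> x _; rewrite -!EFinM -EFinD lee_fin.
have := sqr_ge0 (f x - g x); nra.
Qed.

End SquareIntegral.

Section Completeness.
Context {R : realType} {d : measure_display} {Om : measurableType d}.
Variable P : probability Om R.
Local Open Scope ereal_scope.
Local Notation msq X := (\int[P]_o (X o ^+ 2)%:E).

Variable X : nat -> Om -> R.
Hypothesis mX : forall n, measurable_fun [set: Om] (X n).
Hypothesis cauchy : forall e : R, (0 < e)%R -> exists N : nat, forall m n,
  (N <= m)%N -> (N <= n)%N -> msq (fun o => X m o - X n o)%R <= e%:E.

(** Pointwise |Y| <= 2^-j + 2^j Y^2, and both terms have integral at most 2^-j. The sum is written
    [4 / 2^(j+1)] to fit [epsilon_trick0]. *)
Lemma integral_abs_le (Y : Om -> R) (j : nat) : measurable_fun [set: Om] Y ->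
  msq Y <= (4 ^- j)%:E -> \int[P]_o (`|Y o|)%:E <= (4 / (2 ^ j.+1)%:R)%:E.
Proof.
move=> mY Yj.
have q0 : (0 < 2 ^+ j :> R)%R by rewrite exprn_gt0.
have mY2 : measurable_fun [set: Om] (fun o => (Y o ^+ 2)%:E).
  by apply/measurable_EFinP; exact: measurable_funX.
apply: (@le_trans _ _ (\int[P]_o (cst (2 ^- j)%:E o + (2 ^+ j)%:E * (Y o ^+ 2)%:E))).
  apply: ge0_le_integral => //.
  - by apply/measurable_EFinP; exact: measurableT_comp.
  - by apply: emeasurable_funD => //; exact: measurable_funeM.
  move=> o _; rewrite /cst -EFinM -EFinD lee_fin.
  have E : (2 ^- j = 2 ^+ j * (2 ^- j) ^+ 2 :> R)%R by rewrite expr2 mulrA divff ?mul1r// gt_eqF.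
  rewrite E -mulrDr -ler_pdivrMl//; set c := (2 ^- j)%R.
  rewrite -[X in (_ + X)%R]real_normK ?num_real//.
  have := sqr_ge0 (c - `|Y o|)%R; have c0 : (0 <= c)%R by rewrite invr_ge0 ltW.
  have := normr_ge0 (Y o); move: (`|Y o|)%R => y y0; nra.
rewrite ge0_integralD//; last 3 first.
- by move=> o _; rewrite lee_fin invr_ge0 ltW.
- by move=> o _; rewrite -EFinM lee_fin mulr_ge0 ?sqr_ge0// ltW.
- exact: measurable_funeM.
rewrite integral_cst// ge0_integralZl//; last by move=> o _; rewrite lee_fin sqr_ge0.
rewrite (_ : (2 ^- j)%:E * _ = (2 ^- j)%:E); last first.
  exact: etrans (congr1 (fun z => _ * z) (probability_setT P)) (mule1 _).
apply: (@le_trans _ _ ((2 ^- j)%:E + (2 ^+ j)%:E * (4 ^- j)%:E)).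
  by rewrite leeD2l// lee_wpmul2l// lee_fin ltW.
rewrite -EFinM -EFinD lee_fin.
have -> : (4 ^- j = 2 ^- j * 2 ^- j :> R)%R.
  by rewrite -invfM -exprMn (_ : 2 * 2 = 4)%R//; ring.
rewrite mulrA divff ?gt_eqF// mul1r natrX exprS.
rewrite le_eqVlt; apply/orP; left; apply/eqP; field; rewrite gt_eqF//.
Qed.

(** A fast subsequence has absolutely summable increments almost surely, hence an almost sure limit;
    Fatou turns the Cauchy property into convergence of the whole sequence. *)
Lemma L2_complete : exists2 Z : Om -> R, measurable_fun [set: Om] Z &
  msq (fun o => X n o - Z o)%R @[n --> \oo] --> 0.
Proof.
have cauchy4 j : exists N : nat, forall m n, (N <= m)%N -> (N <= n)%N ->
    msq (fun o => X m o - X n o)%R <= (4 ^- j)%:E.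
  by apply: cauchy; rewrite invr_gt0 exprn_gt0.
have [N HN] := choice cauchy4.
(* Summing the thresholds makes [K] nondecreasing with [N j <= K j]; the added [j] makes [K j]
   exceed any given index eventually. *)
pose K j := (\sum_(i < j.+1) N i + j)%N.
have KN j : (N j <= K j)%N by rewrite /K big_ord_recr/= -addnA addnCA leq_addr.
have KS j : (K j <= K j.+1)%N.
  by rewrite /K [X in (_ <= X + _)%N]big_ord_recr/= leq_add// leq_addr.
have Kj j : msq (fun o => X (K j.+1) o - X (K j) o)%R <= (4 ^- j)%:E.
  by apply: HN => //; exact: leq_trans (KS j).
pose dX j o := (X (K j.+1) o - X (K j) o)%R.
have mdX j : measurable_fun [set: Om] (dX j) by exact: measurable_funB.
pose S o := \sum_(0 <= j <oo) (`|dX j o|)%:E.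
have mabs j : measurable_fun [set: Om] (fun o => (`|dX j o|)%:E).
  by apply/measurable_EFinP; exact: measurableT_comp.
have S0 o : 0 <= S o by apply: nneseries_ge0 => j _ _; rewrite lee_fin.
have mS : measurable_fun [set: Om] S.
  by apply: ge0_emeasurable_sum => // j o _ _; rewrite lee_fin.
have iS : P.-integrable [set: Om] S.
  apply/integrableP; split => //.
  under eq_integral do rewrite gee0_abs//.
  rewrite /S integral_nneseries//.
  apply: (@le_lt_trans _ _ 4%:E); last exact: ltry.
  apply: le_trans (epsilon_trick0 xpredT _) => //.
  apply: lee_nneseries => [j _ _|j _]; first by apply: integral_ge0 => o _; rewrite lee_fin.
  by apply: integral_abs_le => //; exact: Kj.
(* The upper limit is defined and measurable everywhere, and equals the limit wherever there is
   one. *)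
pose Z o := fine (limn_esup (fun j => (X (K j) o)%:E)).
have mZ : measurable_fun [set: Om] Z.
  apply: (measurableT_comp (fine_measurable measurableT)).
  by apply: measurable_fun_limn_esup => j; exact/measurable_EFinP.
have XZ : {ae P, forall o, X (K j) o @[j --> \oo] --> Z o}.
  have := integrable_ae measurableT iS; apply: filterS => o /(_ I) So.
  have c1 : cvgn [normed series (dX ^~ o)].
    apply: nondecreasing_is_cvgn.
      by apply: nondecreasing_series => k _ _ /=.
    exists (fine (S o)) => _ [n _ <-].
    rewrite -lee_fin fineK// /series/= -sumEFin.
    by apply: nneseries_lim_ge => j _ _; rewrite lee_fin.
  have c2 := normed_cvg c1.
  have c3 : X (K j) o @[j --> \oo] --> (X (K 0%N) o + limn (series (dX ^~ o)))%R.
    rewrite (_ : (fun j => X (K j) o) = fun j => (X (K 0%N) o + series (dX ^~ o) j)%R).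
      by apply: cvgD => //; exact: cvg_cst.
    apply/funext => j; rewrite /series/= /dX telescope_sumr// addrC subrK//.
  have c4 : (X (K j) o)%:E @[j --> \oo] --> (X (K 0%N) o + limn (series (dX ^~ o)))%:E.
    by apply: cvg_EFin; [exact: nearW|exact: c3].
  by rewrite /Z (cvg_limn_einf_sup c4).2.
exists Z => //; apply: near_le_cvge0.
  by move=> n; apply: integral_ge0 => o _; rewrite lee_fin sqr_ge0.
move=> e e0; have [N0 HN0] := cauchy e0; exists N0 => // n /= N0n.
pose f j o := ((X n o - X (K j) o) ^+ 2)%:E.
have mf j : measurable_fun [set: Om] (f j).
  by apply/measurable_EFinP; apply: measurable_funX; exact: measurable_funB.
have f0 j o : 0 <= f j o by rewrite lee_fin sqr_ge0.
rewrite (_ : \int[P]_o ((X n o - Z o) ^+ 2)%:E = \int[P]_o limn_einf (f ^~ o)).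
  apply: le_trans (fatou P measurableT mf (fun j o _ => f0 j o)) _.
  apply: limn_einf_near_le; exists N0 => // j /= N0j; apply: HN0 => //.
  by rewrite (leq_trans N0j)// leq_addl.
apply: ge0_ae_eq_integral => //.
- by apply/measurable_EFinP; apply: measurable_funX; exact: measurable_funB.
- rewrite (_ : (fun o => limn_einf (f ^~ o)) =
      -%E \o (fun o => limn_esup (fun j => (-%E \o f j) o)))//.
  apply: measurableT_comp => //.
  apply: measurable_fun_limn_esup => j.
  have mN : measurable_fun [set: Om] (fun o => (- (X n o - X (K j) o) ^+ 2)%:E).
    apply/measurable_EFinP; apply: measurable_funN.
    by apply: measurable_funX; exact: measurable_funB.
  exact: mN.
- by move=> o _; rewrite lee_fin sqr_ge0.
- move=> o _; rewrite limn_einf_lim; apply: lime_ge; first exact: is_cvg_einfs.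
  by apply: nearW => j; apply: le_ereal_inf_tmp => _ [k _ <-].
apply: filterS XZ => o Xo _.
have c5 : f j o @[j --> \oo] --> ((X n o - Z o) ^+ 2)%:E.
  apply: cvg_EFin; first exact: nearW.
  by apply: cvgM; apply: cvgB => //; exact: cvg_cst.
by rewrite (cvg_limn_einf_sup c5).1.
Qed.

End Completeness.

(** * Integrals of step functions *)

Section Subdivision.
Context {R : realType}.
Variables (t : R) (m : nat) (s : nat -> R).
Hypothesis hs : subdivision t m s.

Lemma subdivision_le i j : (i <= j)%N -> (j <= m)%N -> s i <= s j.
Proof.
case: hs => _ _ sS; elim: j => [|j IH]; first by rewrite leqn0 => /eqP ->.
rewrite leq_eqVlt => /orP[/eqP -> //|]; rewrite ltnS => ij jm.
exact: le_trans (IH ij (ltnW jm)) (sS _ jm).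
Qed.

Lemma subdivision_ge0 i : (i <= m)%N -> 0 <= s i.
Proof. by move=> im; case: (hs) => <- _ _; exact: subdivision_le. Qed.

Lemma subdivision_end i : (i <= m)%N -> s i <= t.
Proof. by move=> im; case: (hs) => _ <- _; exact: subdivision_le. Qed.

(** The half-open intervals of a subdivision are disjoint, so the cross terms vanish. *)
Lemma step_fun_sqr (c : nat -> R) x :
  step_fun m s c x ^+ 2 = \sum_(i < m) c i ^+ 2 * \1_(`]s i, s i.+1]%classic) x.
Proof.
rewrite /step_fun expr2 big_distrlr/=; apply: eq_bigr => i _.
have ind2 (A B : set R) : A `&` B = set0 -> \1_A x * \1_B x = 0 :> R.
  move=> AB; rewrite !indicE; case: (boolP (x \in A)); case: (boolP (x \in B));
    rewrite ?mulr0 ?mul0r// !inE => xB xA.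
  by have : (A `&` B) x by []; rewrite AB.
rewrite (bigD1 i)//= big1 ?addr0 => [|j ji].
  have : \1_(`]s i, s i.+1]%classic) x * \1_(`]s i, s i.+1]%classic) x = \1_(`]s i, s i.+1]%classic) x :> R.
    by rewrite indicE; case: (_ \in _); rewrite ?mulr1 ?mulr0.
  by move=> E; rewrite -[in RHS]E; ring.
rewrite mulrACA ind2 ?mulr0//.
apply/seteqP; split => // y /= []; rewrite !in_itv/= => /andP[y1 y2] /andP[y3 y4].
have := ltn_ord i; have := ltn_ord j => jm im.
case: (ltngtP i j) => [ij|ij|ij].
- by have := subdivision_le ij (ltnW jm); lra.
- by have := subdivision_le ij (ltnW im); lra.
- by move: ji; rewrite (val_inj ij) eqxx.
Qed.

Lemma step_fun_measurable (c : nat -> R) (D : set R) : measurable_fun D (step_fun m s c).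
Proof.
apply: measurable_sum => i; apply: measurable_funM => //; exact: measurable_indic.
Qed.

Lemma step_fun_integral (c : nat -> R) :
  (\int[lebesgue_measure]_(x in `[0%R, t]) (step_fun m s c x ^+ 2)%:E =
   (\sum_(i < m) c i ^+ 2 * (s i.+1 - s i))%:E)%E.
Proof.
under eq_integral do rewrite step_fun_sqr -sumEFin.
rewrite ge0_integral_sum//; last 2 first.
- move=> i; apply/measurable_EFinP; apply: measurable_funM => //; exact: measurable_indic.
- by move=> i x _; rewrite lee_fin mulr_ge0 ?sqr_ge0.
rewrite -sumEFin; apply: eq_bigr => i _.
under eq_integral do rewrite EFinM.
rewrite ge0_integralZl_EFin ?sqr_ge0//; last first.
  apply/measurable_EFinP; exact: measurable_indic.
have E : (\int[lebesgue_measure]_(x in `[0%R, t]) (\1_(`]s i, s i.+1]%classic) x)%:E =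
    (s i.+1 - s i)%:E)%E.
  rewrite integral_indic// setIidl; last first.
    move=> x /=; rewrite !in_itv/= => /andP[x1 x2].
    have := subdivision_ge0 (ltnW (ltn_ord i)); have := subdivision_end (ltn_ord i).
    by move=> ? ?; apply/andP; split; lra.
  have sS : s i <= s i.+1 by apply: subdivision_le.
  apply: (etrans (lebesgue_measure_itv `]s i, s i.+1])).
  (* Subdivisions are only weakly increasing, so an interval may be empty. *)
  rewrite /= lte_fin; case: ifPn => // /negP/negP; rewrite -leNgt => sS'.
  have -> : s i.+1 = s i by apply/eqP; rewrite eq_le sS sS'.
  by rewrite subrr.
by rewrite E.
Qed.

End Subdivision.

(** * Step integrals against the cylindrical Wiener process and the Ito isometry *)

Section WienerIntegral.
Context {R : realType} {d : measure_display} {Om : measurableType d}.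
Variable P : probability Om R.
Context {dX : measure_display} {X : measurableType dX}.
Variable mu : {measure set X -> \bar R}.
Variable W : (X -> R) -> R -> {RV P >-> R}.
Hypothesis hW : cylindrical_wiener mu W.
Local Notation L2mu := (Lfun mu 2%:E).
Local Notation L2P := (Lfun P 2%:E).

Lemma wiener_L2 f t : f \in L2mu -> 0 <= t -> (W f t : Om -> R) \in L2P.
Proof.
move=> fL t0; apply/L2_iff; split=> //.
have := cw_covariance hW fL fL t0 t0; rewrite unlock => E.
by under eq_integral do rewrite expr2; rewrite E ltry.
Qed.

Lemma wiener_inner f g s t : f \in L2mu -> g \in L2mu -> 0 <= s -> 0 <= t ->
  inner P (W f s) (W g t) = Num.min s t * inner mu f g.
Proof.
move=> fL gL s0 t0; have := cw_covariance hW fL gL s0 t0; rewrite unlock => E.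
by rewrite /inner /Rintegral E.
Qed.

Definition increment (f : X -> R) (s t : R) (o : Om) : R := W f t o - W f s o.

Lemma incrementE f s t : increment f s t = fun o => -1 * W f s o + W f t o.
Proof. by apply/funext => o; rewrite /increment; ring. Qed.

Lemma increment_L2 f s t : f \in L2mu -> 0 <= s -> 0 <= t -> increment f s t \in L2P.
Proof. by move=> fL s0 t0; rewrite incrementE; apply: L2_lincomb; exact: wiener_L2. Qed.

Lemma increment_inner f g s s' t t' : f \in L2mu -> g \in L2mu ->
  0 <= s -> 0 <= s' -> 0 <= t -> 0 <= t' ->
  inner P (increment f s s') (increment g t t') =
  (Num.min s' t' - Num.min s t' - Num.min s' t + Num.min s t) * inner mu f g.
Proof.
move=> fL gL s0 s'0 t0 t'0.
have iL := increment_L2 gL t0 t'0.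
rewrite incrementE innerP ?wiener_L2// !(innerC _ _ (increment _ _ _)) incrementE.
by rewrite !innerP ?wiener_L2// !wiener_inner// (innerC _ g f) !(minC _ t) !(minC _ t'); ring.
Qed.

Lemma step_integralE f m s c : step_integral (fun s => W f s : Om -> R) m s c =
  fun o => \sum_(i < m) c i * increment f (s i) (s i.+1) o.
Proof. by []. Qed.

Section Ito.
Variables (K : nat) (t : R) (phi : nat -> X -> R).
Hypothesis phiL : forall k, phi k \in L2mu.
Hypothesis phi_orth : forall k l, inner mu (phi k) (phi l) = (k == l)%:R.
Variables (m : nat -> nat) (s c : nat -> nat -> R).
Hypothesis hs : forall k, subdivision t (m k) (s k).

Let S k := step_integral (fun u => W (phi k) u : Om -> R) (m k) (s k) (c k).

Let inc_L2 k (i : 'I_(m k)) : increment (phi k) (s k i) (s k i.+1) \in L2P.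
Proof.
apply: increment_L2 => //; first exact: (subdivision_ge0 (hs k) (ltnW (ltn_ord i))).
exact: (subdivision_ge0 (hs k) (ltn_ord i)).
Qed.

Lemma step_integral_L2 k : S k \in L2P.
Proof. by apply: (L2_sum (index_enum 'I_(m k)) (fun i => c k i)) => i; exact: inc_L2. Qed.

(** For distinct modes orthogonality of [phi] kills every term, however the two subdivisions
    interlace. For one mode, increments over disjoint intervals are uncorrelated because the four
    minima cancel. *)
Lemma step_integral_inner k l : inner P (S k) (S l) =
  (k == l)%:R * \sum_(i < m k) c k i ^+ 2 * (s k i.+1 - s k i).
Proof.
rewrite {1}/S step_integralE.
rewrite (inner_suml (index_enum 'I_(m k)) (fun i => c k i)); [|exact: inc_L2|exact: step_integral_L2].
rewrite mulr_sumr; apply: eq_bigr => i _.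
rewrite /S step_integralE (inner_sumr (index_enum 'I_(m l)) (fun i => c l i)); [|exact: inc_L2|exact: inc_L2].
have ge0 k' (j : 'I_(m k')) : 0 <= s k' j by exact: (subdivision_ge0 (hs k') (ltnW (ltn_ord j))).
have geS k' (j : 'I_(m k')) : 0 <= s k' j.+1 by exact: (subdivision_ge0 (hs k') (ltn_ord j)).
under eq_bigr do rewrite increment_inner// phi_orth.
have [kl|kl] := eqVneq k l; last by rewrite big1 ?mulr0 ?mul0r// => j _; rewrite !mulr0.
subst l; rewrite (bigD1 i)//= big1 => [|j ji].
  have le := subdivision_le (hs k) (leqnSn i) (ltn_ord i).
  by rewrite !minxx (min_idPl le) (min_idPr le); ring.
have jm := ltn_ord j; have im := ltn_ord i.
rewrite mulr1.
case: (ltngtP i j) => [ij|ij|ij].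
- have l1 := subdivision_le (hs k) ij (ltnW jm).
  have l2 := subdivision_le (hs k) (leqnSn i) im.
  have l3 := subdivision_le (hs k) (leqnSn j) jm.
  have l4 := le_trans l2 l1; have l5 := le_trans l1 l3; have l6 := le_trans l4 l3.
  by rewrite (min_idPl l1) (min_idPl l4) (min_idPl l5) (min_idPl l6); ring.
- have l1 := subdivision_le (hs k) ij (ltnW im).
  have l2 := subdivision_le (hs k) (leqnSn j) jm.
  have l3 := subdivision_le (hs k) (leqnSn i) im.
  have l4 := le_trans l2 l1; have l5 := le_trans l1 l3; have l6 := le_trans l4 l3.
  by rewrite (min_idPr l1) (min_idPr l4) (min_idPr l5) (min_idPr l6); ring.
- by move: ji; rewrite (val_inj ij) eqxx.
Qed.

Lemma ito_isometry (alpha : nat -> R) :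
  (\int[P]_o ((\sum_(k < K) alpha k * S k o) ^+ 2)%:E =
   (\sum_(k < K) alpha k ^+ 2 * \sum_(i < m k) c k i ^+ 2 * (s k i.+1 - s k i))%:E)%E.
Proof.
have SL (k : 'I_K) : S k \in L2P by exact: step_integral_L2.
have TL := L2_sum (index_enum 'I_K) (fun k => alpha k) SL.
rewrite (inner_sqr TL); congr (_%:E).
rewrite (inner_suml (index_enum 'I_K) (fun k => alpha k) SL TL); apply: eq_bigr => k _.
rewrite (inner_sumr (index_enum 'I_K) (fun k => alpha k) SL (SL k)).
rewrite (bigD1 k)//= big1 ?addr0 => [|l lk].
  by rewrite step_integral_inner eqxx mul1r expr2 mulrA.
rewrite step_integral_inner (_ : (k == l :> nat) = false) ?mul0r ?mulr0//.
by apply/negbTE; rewrite eq_sym.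
Qed.

End Ito.

(** The variables that [cw_gaussian] declares Gaussian. Being closed under linear combinations, they
    contain sums of step integrals of several modes over unrelated subdivisions. *)
Definition elementary (Z : Om -> R) : Prop :=
  exists (n : nat) (c : 'I_n -> R) (f : 'I_n -> X -> R) (t : 'I_n -> R),
  [/\ forall i, f i \in L2mu, forall i, 0 <= t i &
      Z = fun o => \sum_(i < n) c i * W (f i) (t i) o].

Lemma elementary_gaussian Z : elementary Z -> centred_gaussian P Z.
Proof. by move=> [n [c [f [t [fL t0 ->]]]]]; exact: (cw_gaussian hW). Qed.

Lemma elementary_wiener f t : f \in L2mu -> 0 <= t -> elementary (W f t).
Proof.
move=> fL t0; exists 1%N, (fun=> 1), (fun=> f), (fun=> t); split => //.
by apply/funext => o; rewrite big_ord1 mul1r.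
Qed.

Lemma elementary0 : elementary (fun=> 0).
Proof.
exists 0%N, (fun=> 0), (fun=> fun=> 0), (fun=> 0); split => //; try by case.
by apply/funext => o; rewrite big_ord0.
Qed.

Lemma elementary_lincomb a Y Z : elementary Y -> elementary Z ->
  elementary (fun o => a * Y o + Z o).
Proof.
move=> [n [c [f [t [fL t0 ->]]]]] [n' [c' [f' [t' [f'L t'0 ->]]]]].
exists (n + n')%N,
  (fun i => match fintype.split i with inl j => a * c j | inr j => c' j end),
  (fun i => match fintype.split i with inl j => f j | inr j => f' j end),
  (fun i => match fintype.split i with inl j => t j | inr j => t' j end); split.
- by move=> i; case: fintype.split.
- by move=> i; case: fintype.split.
apply/funext => o; rewrite big_split_ord/= mulr_sumr; congr (_ + _); apply: eq_bigr => i _.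
  by have := unsplitK (inl i : 'I_n + 'I_n') => /= ->; rewrite mulrA.
by have := unsplitK (inr i : 'I_n + 'I_n') => /= ->.
Qed.

Lemma elementary_sum (I : Type) (r : seq I) (a : I -> R) (Z : I -> Om -> R) :
  (forall i, elementary (Z i)) -> elementary (fun o => \sum_(i <- r) a i * Z i o).
Proof.
move=> eZ; elim: r => [|i r IH].
  by under eq_fun do rewrite big_nil; exact: elementary0.
by under eq_fun do rewrite big_cons; exact: elementary_lincomb.
Qed.

Lemma step_integral_elementary f t m s c : f \in L2mu -> subdivision t m s ->
  elementary (step_integral (fun u => W f u : Om -> R) m s c).
Proof.
move=> fL hs; rewrite step_integralE.
apply: (elementary_sum (index_enum 'I_m) (fun i => c i)) => i.
rewrite incrementE; apply: elementary_lincomb; apply: elementary_wiener => //.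
  exact: (subdivision_ge0 hs (ltnW (ltn_ord i))).
exact: (subdivision_ge0 hs (ltn_ord i)).
Qed.

End WienerIntegral.

(** * Sums of modes *)

(* The integral of a nonnegative function is a supremum over simple functions,
   so monotonicity needs no measurability: [norm2 mu (u o - _)] is not assumed
   to be measurable in [o]. *)
Lemma ge0_integral_le_nonmeasurable {d} {T : measurableType d} {R : realType}
    (mu : {measure set T -> \bar R}) (f g : T -> \bar R) :
  (forall x, 0 <= f x)%E -> (forall x, f x <= g x)%E ->
  (\int[mu]_x f x <= \int[mu]_x g x)%E.
Proof.
move=> f0 fg; rewrite !ge0_integralTE//; last by move=> x; exact: le_trans (fg x).
apply: ge_ereal_sup => _ [h /= hf <-]; apply: ereal_sup_ubound; exists h => //= x.
exact: le_trans (fg x).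
Qed.

Section ModeSums.
Context {R : realType} {d : measure_display} {Om : measurableType d}.
Variable P : probability Om R.
Context {dX : measure_display} {X : measurableType dX}.
Variable mu : {measure set X -> \bar R}.
Variable W : (X -> R) -> R -> {RV P >-> R}.
Hypothesis hW : cylindrical_wiener mu W.
Local Notation msq X := (\int[P]_o (X o ^+ 2)%:E)%E.

Lemma msqZ (a : R) (Z : Om -> R) : measurable_fun [set: Om] Z ->
  (\int[P]_o ((a * Z o) ^+ 2)%:E = (a ^+ 2)%:E * msq Z)%E.
Proof.
move=> mZ; rewrite -ge0_integralZl_EFin ?sqr_ge0//; last 2 first.
- by move=> o _; rewrite lee_fin sqr_ge0.
- by apply/measurable_EFinP; exact: measurable_funX.
by apply: eq_integral => o _; rewrite exprMn EFinM.
Qed.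

Lemma measurable_lincomb (K : nat) (a : nat -> R) (Z : nat -> Om -> R) :
  (forall k, measurable_fun [set: Om] (Z k)) ->
  measurable_fun [set: Om] (fun o => \sum_(k < K) a k * Z k o).
Proof. by move=> mZ; apply: measurable_sum => k; exact: measurable_funM. Qed.

Lemma cvg_msq_sum (K : nat) (a : nat -> R) (Z : nat -> nat -> Om -> R) :
  (forall k n, measurable_fun [set: Om] (Z k n)) ->
  (forall k, msq (Z k n) @[n --> \oo] --> 0%E) ->
  (\int[P]_o ((\sum_(k < K) a k * Z k n o) ^+ 2)%:E)%E @[n --> \oo] --> 0%E.
Proof.
move=> mZ Z0; elim: K => [|K IH].
  apply: near_le_cvge0 => [n|e e0]; first by apply: integral_ge0 => o _; rewrite lee_fin sqr_ge0.
  apply: nearW => n; under eq_integral do rewrite big_ord0 expr0n/=.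
  by rewrite integral0 lee_fin ltW.
have c : ((2%:E * ((a K ^+ 2)%:E * msq (Z K n)) +
    2%:E * \int[P]_o ((\sum_(k < K) a k * Z k n o) ^+ 2)%:E)%E @[n --> \oo] -->
    (2%:E * ((a K ^+ 2)%:E * 0) + 2%:E * 0)%E).
  by apply: cvgeD => //; do 2?apply: cvgeZl => //; rewrite !mule0.
rewrite !mule0 adde0 in c.
apply: (squeeze_cvge _ (cvg_cst 0%E) c); apply: nearW => n; apply/andP; split.
  by apply: integral_ge0 => o _; rewrite lee_fin sqr_ge0.
rewrite -msqZ//; under eq_integral do rewrite big_ord_recr/= addrC.
have mK : measurable_fun [set: Om] (fun o => a K * Z K n o) by exact: measurable_funM.
exact: (sqr_integralD_le P measurableT mK (measurable_lincomb K a (mZ ^~ n))).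
Qed.

Variables (t : R) (phi : nat -> X -> R) (h : nat -> R -> R) (Y : nat -> Om -> R).
Hypothesis phiL : forall k, phi k \in Lfun mu 2%:E.
Hypothesis phi_orth : forall k l, inner mu (phi k) (phi l) = (k == l)%:R.
Hypothesis hY : forall k, is_wiener_integral P (fun s => W (phi k) s) t (h k) (Y k).
Hypothesis mY : forall k, measurable_fun [set: Om] (Y k).
Variable B : nat -> R.
Hypothesis mh : forall k, measurable_fun `[0, t] (h k).
Hypothesis hB : forall k, (\int[lebesgue_measure]_(s in `[0%R, t]) (h k s ^+ 2)%:E <= (B k)%:E)%E.

(* The factor [2] comes from [(x + y)^2 <= 2 x^2 + 2 y^2]; only the final
   constant depends on it. *)
Lemma mode_sum_approximation (K : nat) (a : nat -> R) : exists T : nat -> Om -> R,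
  [/\ forall n, elementary mu W (T n), cvg_L2 P T (fun o => \sum_(k < K) a k * Y k o) &
      forall e : R, 0 < e -> \forall n \near \oo,
        (msq (T n) <= (2 * (\sum_(k < K) a k ^+ 2 * B k) + e)%:E)%E].
Proof.
have ex k : exists q : (nat -> nat) * (nat -> nat -> R) * (nat -> nat -> R),
  [/\ forall n, subdivision t (q.1.1 n) (q.1.2 n),
      (fun n => \int[lebesgue_measure]_(x in `[0%R, t])
         ((h k x - step_fun (q.1.1 n) (q.1.2 n) (q.2 n) x) ^+ 2)%R%:E)%E @ \oo --> 0%E &
      cvg_L2 P (fun n => step_integral (fun s => W (phi k) s : Om -> R)
        (q.1.1 n) (q.1.2 n) (q.2 n)) (Y k)].
  by case: (hY k) => m [s [c Hk]]; exists (m, s, c).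
have [q Hq] := choice ex.
pose m k := (q k).1.1; pose s k := (q k).1.2; pose c k := (q k).2.
pose S k n := step_integral (fun u => W (phi k) u : Om -> R) (m k n) (s k n) (c k n).
have hs k n : subdivision t (m k n) (s k n) by case: (Hq k) => H _ _; exact: H.
have eS k n : elementary mu W (S k n) by exact: step_integral_elementary.
have mS k n : measurable_fun [set: Om] (S k n) by case: (elementary_gaussian hW (eS k n)).
exists (fun n o => \sum_(k < K) a k * S k n o); split.
- by move=> n; apply: (elementary_sum (index_enum 'I_K) (fun k => a k)) => k; exact: eS.
- rewrite /cvg_L2.
  rewrite (_ : (fun n => _) = fun n =>
      (\int[P]_o ((\sum_(k < K) a k * (S k n o - Y k o)) ^+ 2)%:E)%E); last first.
    apply/funext => n; rewrite unlock; apply: eq_integral => o _; congr ((_ ^+ 2)%:E).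
    by rewrite -sumrB; apply: eq_bigr => k _; rewrite mulrBr.
  apply: (@cvg_msq_sum K a (fun k n o => S k n o - Y k o)).
    by move=> k n; exact: measurable_funB.
  by move=> k; case: (Hq k) => _ _; rewrite /cvg_L2 unlock.
move=> e e0.
pose A := \sum_(k < K) a k ^+ 2.
have A0 : 0 <= A by apply: sumr_ge0 => k _; exact: sqr_ge0.
(* Then [A * (2 * e') <= e]; the added 1 covers the case [A = 0]. *)
pose e' := e / (2 * (A + 1)).
have A1 : 0 < 2 * (A + 1) by rewrite mulr_gt0// ltr_wpDl.
have e'0 : 0 < e' by rewrite divr_gt0.
have near_step : \forall n \near \oo, forall k : 'I_K,
    (\int[lebesgue_measure]_(x in `[0%R, t])
       ((h k x - step_fun (m k n) (s k n) (c k n) x) ^+ 2)%R%:E <= e'%:E)%E.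
  apply: filter_forall => k; case: (Hq k) => _ H _.
  exact: cvge0_near_le H e'0.
apply: filterS near_step => n Hn.
rewrite (ito_isometry hW K phiL phi_orth (c ^~ n) (hs ^~ n)) lee_fin.
apply: (@le_trans _ _ (\sum_(k < K) a k ^+ 2 * (2 * B k + 2 * e'))).
  apply: ler_sum => k _; rewrite ler_wpM2l ?sqr_ge0// -lee_fin -(step_fun_integral (hs k n)).
  have mstep : measurable_fun `[0, t] (step_fun (m k n) (s k n) (c k n)) by exact: step_fun_measurable.
  (* The step function is split as [h k] plus the approximation error. *)
  under eq_integral => x _ do rewrite -[step_fun _ _ _ x](subrK (h k x)) addrC.
  apply: le_trans (sqr_integralD_le lebesgue_measure (measurable_itv _) (mh k) (measurable_funB mstep (mh k))) _.
  apply: (@le_trans _ _ (2%:E * (B k)%:E + 2%:E * e'%:E)%E); last by rewrite -!EFinM -EFinD.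
  apply: leeD; apply: lee_wpmul2l; rewrite ?lee_fin//.
  rewrite (le_trans _ (Hn k))//; under eq_integral => x _ do rewrite -sqrrN opprB.
  by [].
rewrite mulr_sumr; under eq_bigr do rewrite mulrDr.
rewrite big_split/= -mulr_suml -/A.
apply: lerD; first by rewrite le_eqVlt; apply/orP; left; apply/eqP; apply: eq_bigr => k _; ring.
have -> : A * (2 * e') = e * (A / (A + 1)) by rewrite /e'; field; rewrite gt_eqF// ltr_wpDl.
by rewrite ler_piMr ?(ltW e0)// ler_pdivrMr ?ltr_wpDl// mul1r lerDl.
Qed.

Lemma mode_sum_gaussian (K : nat) (a : nat -> R) :
  centred_gaussian P (fun o => \sum_(k < K) a k * Y k o).
Proof.
have [T [eT TY _]] := mode_sum_approximation K a.
apply: (gaussian_limit _ _ TY); last exact: measurable_lincomb.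
by move=> n; exact: elementary_gaussian (eT n).
Qed.

(** The 4 is the 2 of [mode_sum_approximation] times a 2 from splitting off the distance to the
    approximating variable. *)
Lemma mode_sum_msq (K : nat) (a : nat -> R) :
  (\int[P]_o ((\sum_(k < K) a k * Y k o) ^+ 2)%:E <=
   (4 * \sum_(k < K) a k ^+ 2 * B k)%:E)%E.
Proof.
have [T [eT + msqT]] := mode_sum_approximation K a.
rewrite /cvg_L2 unlock => TY.
have mT n : measurable_fun [set: Om] (T n) by case: (elementary_gaussian hW (eT n)).
have mS := measurable_lincomb K a mY.
apply/lee_addgt0Pr => e e0.
have e4 : 0 < e / 4 by rewrite divr_gt0.
have [N1 _ H1] := msqT _ e4; have [N2 _ H2] := cvge0_near_le TY e4.
pose n := maxn N1 N2.
have {}H1 := H1 n (leq_maxl _ _); have {}H2 := H2 n (leq_maxr _ _).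
under eq_integral => o _ do rewrite -[X in X ^+ 2](subrK (T n o)) addrC.
apply: le_trans (sqr_integralD_le P measurableT (mT n) (measurable_funB mS (mT n))) _.
under [X in (_ + _ * X)%E]eq_integral => o _ do rewrite -sqrrN opprB.
apply: (@le_trans _ _ (2%:E * (2 * (\sum_(k < K) a k ^+ 2 * B k) + e / 4)%:E + 2%:E * (e / 4)%:E)%E).
  by apply: leeD; apply: lee_wpmul2l; rewrite ?lee_fin.
rewrite -!EFinM -!EFinD lee_fin; lra.
Qed.

End ModeSums.

(** * Point evaluation *)

Section PointEvaluation.
Context {R : realType} {d : measure_display} {Om : measurableType d}.
Variable P : probability Om R.
Variables (Y : nat -> Om -> R) (w : nat -> R) (A C : R) (v : nat -> R).
Hypothesis mY : forall k, measurable_fun [set: Om] (Y k).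
Hypothesis A0 : 0 < A.
Hypothesis w0 : forall k, 0 < w k.
Hypothesis msqY : forall (K : nat) (a : nat -> R),
  (\int[P]_o ((\sum_(k < K) a k * Y k o) ^+ 2)%:E <=
   (A * \sum_(k < K) a k ^+ 2 / w k)%:E)%E.
Hypothesis vC : forall K, \sum_(k < K) v k ^+ 2 / w k <= C.

Lemma mode_series_cvg : exists2 Z : Om -> R, measurable_fun [set: Om] Z &
  cvg_L2 P (fun K o => \sum_(k < K) Y k o * v k) Z.
Proof.
pose S K o := \sum_(k < K) v k * Y k o.
have mS K : measurable_fun [set: Om] (S K) by exact: measurable_lincomb.
pose g K := \sum_(k < K) v k ^+ 2 / w k.
have g_nd : nondecreasing_seq g.
  apply/nondecreasing_seqP => n; rewrite /g [leRHS]big_ord_recr/= lerDl.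
  by rewrite divr_ge0 ?sqr_ge0// ltW.
have gcvg : cvgn g.
  by apply: nondecreasing_is_cvgn => //; exists C => _ [n _ <-]; exact: vC.
have gL n : g n <= limn g by exact: nondecreasing_cvgn_le.
have SS m n : (m <= n)%N ->
    (\int[P]_o ((S n o - S m o) ^+ 2)%:E <= (A * (g n - g m))%:E)%E.
  (* Zero coefficients below [m] turn a difference of partial sums into a sum from 0, the shape to
     which [msqY] applies. *)
  move=> mn; pose a k := if (k < m)%N then 0 else v k.
  have sumD (G G' : nat -> R) : (forall k, (k < m)%N -> G k = 0) ->
      (forall k, (m <= k)%N -> G k = G' k) ->
      \sum_(k < n) G k = \sum_(k < n) G' k - \sum_(k < m) G' k.
    move=> G0 GG'.
    rewrite -!(big_mkord xpredT) (big_cat_nat (n := m))//= big1_seq ?add0r; last first.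
      by move=> k; rewrite mem_index_iota => /andP[_ /andP[_ km]]; exact: G0.
    rewrite [X in X - _](big_cat_nat (n := m))//= addrAC subrr add0r.
    by apply: eq_big_nat => k /andP[mk _]; exact: GG'.
  have -> : g n - g m = \sum_(k < n) a k ^+ 2 / w k.
    apply/esym; apply: (sumD (fun k => a k ^+ 2 / w k) (fun k => v k ^+ 2 / w k)) => k; rewrite /a.
      by move=> ->; rewrite expr0n mul0r.
    by rewrite ltnNge => ->.
  under eq_integral => o _.
    rewrite -(sumD (fun k => a k * Y k o) (fun k => v k * Y k o)); last 2 first.
    - by move=> k; rewrite /a => ->; rewrite mul0r.
    - by move=> k; rewrite /a ltnNge => ->.
    over.
  exact: msqY.
have cauchy (e : R) : 0 < e -> exists N : nat, forall m n, (N <= m)%N -> (N <= n)%N ->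
    (\int[P]_o ((S m o - S n o) ^+ 2)%:E <= e%:E)%E.
  move=> e0; have eA : 0 < e / A by rewrite divr_gt0.
  have [N _ HN] : \forall n \near \oo, limn g - e / A < g n.
    by apply: (cvgr_gt _ gcvg); rewrite ltrBlDr ltrDl.
  have H m n : (N <= m)%N -> (m <= n)%N -> A * (g n - g m) <= e.
    move=> Nm mn; rewrite mulrC -ler_pdivlMr// lerBlDr.
    by have := HN m Nm; have := gL n => /= ? ?; lra.
  exists N => m n Nm Nn; have [mn|nm] := leqP m n.
    under eq_integral do rewrite -sqrrN opprB.
    by apply: le_trans (SS _ _ mn) _; rewrite lee_fin H.
  by apply: le_trans (SS _ _ (ltnW nm)) _; rewrite lee_fin H// ltnW.
have [Z mZ SZ] := L2_complete mS cauchy.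
exists Z => //; have -> : (fun K o => \sum_(k < K) Y k o * v k) = S.
  by apply/funext => K; apply/funext => o; apply: eq_bigr => k _; rewrite mulrC.
by rewrite /cvg_L2 unlock.
Qed.

End PointEvaluation.

(** Cauchy-Schwarz for each outcome bounds the squared error by the squared norm of [f] times that
    of the remainder of the series for [u]. *)
Lemma inner_average_cvg {R : realType} {d : measure_display} {Om : measurableType d}
    (P : probability Om R) {dX : measure_display} {X : measurableType dX}
    (mu : {measure set X -> \bar R}) (u : Om -> X -> R) (f : X -> R)
    (Y : nat -> Om -> R) (phi : nat -> X -> R) :
  (forall o, u o \in Lfun mu 2%:E) -> f \in Lfun mu 2%:E ->
  (forall k, phi k \in Lfun mu 2%:E) ->
  measurable_fun [set: Om] (fun o => inner mu (u o) f) ->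
  (forall k, measurable_fun [set: Om] (Y k)) ->
  (fun K => \int[P]_o (norm2 mu (fun x =>
       u o x - \sum_(k < K) Y k o * phi k x)%R ^+ 2))%E @ \oo --> 0%E ->
  (\int[P]_o ((inner mu (u o) f - \sum_(k < K) inner mu (phi k) f * Y k o) ^+ 2)%:E)%E
    @[K --> \oo] --> 0%E.
Proof.
move=> uL fL phiL mu_f mY cv.
(* The added 1 keeps [C] positive, so that it can be divided by even when [f] is null. *)
pose C := inner mu f f + 1.
have C0 : 0 < C by rewrite ltr_wpDl// inner_ge0.
have mD K : measurable_fun [set: Om]
    (fun o => inner mu (u o) f - \sum_(k < K) inner mu (phi k) f * Y k o).
  apply: measurable_funB => //.
  exact: (measurable_lincomb K (fun k => inner mu (phi k) f) mY).
have le K : (\int[P]_o ((inner mu (u o) f - \sum_(k < K) inner mu (phi k) f * Y k o) ^+ 2)%:E <=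
    C%:E * \int[P]_o (norm2 mu (fun x => u o x - \sum_(k < K) Y k o * phi k x)%R ^+ 2))%E.
  rewrite muleC -lee_pdivrMr// muleC -ge0_integralZl_EFin ?invr_ge0 ?(ltW C0)//; last 2 first.
  - by move=> o _; rewrite lee_fin sqr_ge0.
  - by apply/measurable_EFinP; exact: measurable_funX.
  apply: ge0_integral_le_nonmeasurable => o.
    by rewrite -EFinM lee_fin mulr_ge0 ?sqr_ge0// invr_ge0 ltW.
  have SL := L2_sum (index_enum 'I_K) (fun k => Y k o) (fun k => phiL k).
  pose z x := -1 * (\sum_(k < K) Y k o * phi k x) + u o x.
  have zL : z \in Lfun mu 2%:E by exact: L2_lincomb.
  have -> : (fun x => u o x - \sum_(k < K) Y k o * phi k x) = z.
    by apply/funext => x; rewrite /z mulN1r addrC.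
  rewrite norm2_sqr inner_sqr// -EFinM lee_fin mulrC ler_pdivrMr//.
  have -> : inner mu (u o) f - \sum_(k < K) inner mu (phi k) f * Y k o = inner mu z f.
    rewrite /z innerP// (inner_suml (index_enum 'I_K) (fun k => Y k o) (fun k => phiL k))//.
    by rewrite mulN1r addrC; congr (- _ + _); apply: eq_bigr => k _; rewrite mulrC.
  rewrite (le_trans (cauchy_schwarz zL fL))// ler_wpM2l ?inner_ge0//.
  by rewrite /C lerDl.
have c : (C%:E * \int[P]_o (norm2 mu (fun x => u o x - \sum_(k < K) Y k o * phi k x)%R ^+ 2))%E
    @[K --> \oo] --> (C%:E * 0)%E by exact: cvgeZl.
rewrite mule0 in c; apply: (squeeze_cvge _ (cvg_cst 0%E) c).
apply: nearW => K; rewrite le andbT.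
by apply: integral_ge0 => o _; rewrite lee_fin sqr_ge0.
Qed.

Theorem theorem3p9 (R : realType) (F : pmetricType R) (M : nat)
  (psi : 'I_M -> F -> F) (pi : (nat -> 'I_M) -> F)
  (hF : pcf_self_similar_set psi pi)
  (a : F -> F -> R) (r : 'I_M -> R)
  (hA : regular_harmonic_structure psi pi a r)
  (mu : probability (borel F) R) (dH : R)
  (hmu : self_similar_measure psi r mu dH)
  (c5 : R) (hc5 : 0 < c5) (D : F -> nat -> set (borel F))
  (hD : neighbourhoods psi pi a r mu dH c5 D)
  (beta : R) (hbeta : 0 <= beta)
  (b : set F) (hb : b `<=` bdry psi pi)
  (lam : nat -> R) (phi : nat -> F -> R)
  (hphi : eigenbasis psi pi a r mu b lam phi)
  (V : R -> R -> R)
  (hV : forall l : R, 0 <= l -> damped_oscillator beta l (V l))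
  (d : measure_display) (Om : measurableType d) (P : probability Om R)
  (W : (borel F -> R) -> R -> {RV P >-> R})
  (hW : cylindrical_wiener mu W)
  (Y : nat -> R -> {RV P >-> R})
  (hY : mode_processes W V lam phi Y)
  (u : R -> Om -> borel F -> R)
  (hu : spde_solution mu Y phi u) :
  exists utx : R -> F -> {RV P >-> R},
    (forall t x, 0 <= t ->
       cvg_L2 P (fun K o => \sum_(k < K) Y k t o * phi k x) (utx t x) /\
       centred_gaussian P (utx t x)) /\
    exists2 c6 : R, 0 < c6 &
      forall x t n, 0 <= t ->
      ('E_P[(fun o => (inner mu (u t o) (normalized_indicator mu (D x n))
                       - utx t x o) ^+ 2)%R]
       <= (c6 * expR (2 * (Num.sqrt (beta ^+ 2 + 1) - beta) * t)
           * 2 ^- n)%:E)%E.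
Proof.
have F0_fin : finite_set (bdry psi pi) by apply: finite_image; case: hF.
have phiL k := eigenfun_L2 hphi k.
pose gam := Num.sqrt (beta ^+ 2 + 1) - beta.
have gam0 : 0 < gam := damping_rate_gt0 hbeta.
pose w k := 1 + lam k.
have w0 k : 0 < w k := lam1_gt0 hphi k.
(* The 4 comes from [mode_sum_msq], the quotient from [oscillator_sqr_integral], whose remaining
   factor [(1 + lam k)^-1] is the weight [(w k)^-1]. *)
pose A (t : R) := 4 * (expR (2 * gam * t) / (2 * gam)).
have A0 (t : R) : 0 < A t by rewrite mulr_gt0// divr_gt0 ?expR_gt0// mulr_gt0.
have mY t k : measurable_fun [set: Om] (Y k t) by [].
pose h t k s := V (lam k) (t - s).
have mh (t : R) k : measurable_fun `[0, t] (h t k).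
  have H := @oscillator_reversed_measurable R beta (lam k) (V (lam k)) (hV (lam k) (eb_ge0 hphi k)) t.
  exact: H.
have hB (t : R) k : 0 <= t -> (\int[lebesgue_measure]_(s in `[0%R, t]) (h t k s ^+ 2)%:E <=
    (expR (2 * gam * t) / (2 * gam) / w k)%:E)%E.
  move=> t0; have := oscillator_sqr_integral hbeta (eb_ge0 hphi k) (hV (lam k) (eb_ge0 hphi k)) t0.
  by rewrite invfM mulrA.
have hYt (t : R) : 0 <= t -> forall k, is_wiener_integral P (fun s => W (phi k) s) t (h t k) (Y k t).
  by move=> t0 k; exact: hY.
have msqY (t : R) : 0 <= t -> forall (K : nat) (q : nat -> R),
    (\int[P]_o ((\sum_(k < K) q k * Y k t o) ^+ 2)%:E <=
     (A t * \sum_(k < K) q k ^+ 2 / w k)%:E)%E.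
  move=> t0 K q.
  apply: le_trans (mode_sum_msq hW phiL (eb_orthonormal hphi) (hYt t t0) (mY t) (mh t)
    (fun k => hB t k t0) K q) _.
  rewrite lee_fin le_eqVlt; apply/orP; left; apply/eqP; rewrite /A -[RHS]mulrA [in RHS]mulr_sumr.
  by congr (_ * _); apply: eq_bigr => k _; rewrite mulrCA.
have muD x n : (0 < mu (D x n))%E.
  by apply: le_lt_trans (nb_measure hD x n); rewrite lee_fin mulr_ge0 ?powR_ge0.
have mD := nb_measurable hD.
have e0 n : 0 <= c5 * 2 ^- n by rewrite mulr_ge0 ?(ltW hc5)// invr_ge0 exprn_ge0.
have osc x n K := resolvent_oscillation F0_fin hA hphi (mD x n) (muD x n) (e0 n) (@nb_ball _ _ _ _ _ _ _ _ _ _ _ hD x n) K.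
(* A single neighbourhood, here that of index 0, already gives a bound uniform in [K]. *)
have diag x K := resolvent_diag F0_fin hA hphi (mD x 0%N) (muD x 0%N) (e0 0%N) (@nb_ball _ _ _ _ _ _ _ _ _ _ _ hD x 0%N) K.
have ex (p : R * F) : exists Z : {RV P >-> R}, 0 <= p.1 ->
    cvg_L2 P (fun K o => \sum_(k < K) Y k p.1 o * phi k p.2) Z /\ centred_gaussian P Z.
  case: p => t x /=; have [t0|t0] := leP 0 t; last first.
    (* A placeholder for negative times, about which nothing is claimed. *)
    by exists (Y 0%N t) => ?.
  have [Z mZ SZ] := mode_series_cvg (v := phi ^~ x) (mY t) (A0 t) w0 (msqY t t0) (diag x).
  exists (mfun_Sub (mem_set mZ : Z \in mfun)) => _; split => //.
  apply: (gaussian_limit _ mZ SZ) => K.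
  have := mode_sum_gaussian hW phiL (eb_orthonormal hphi) (hYt t t0) (mY t) (mh t)
    (fun k => hB t k t0) K (phi ^~ x).
  by under eq_fun do under eq_bigr do rewrite mulrC.
have [f Hf] := choice ex.
exists (fun t x => f (t, x)); split; first by move=> t x t0; exact: (Hf (t, x)).
(* [4 A t c5 2^-n], where the [4] comes from splitting the error in three parts. *)
exists (8 * c5 / gam).
  by rewrite divr_gt0// mulr_gt0.
move=> x t n t0; have [SZ _] := Hf (t, x) t0.
move: SZ; set Z := f (t, x); rewrite /= /cvg_L2 unlock => SZ.
set g := normalized_indicator mu (D x n).
have gL : g \in Lfun mu 2%:E by exact: normalized_indicator_L2.
have mU : measurable_fun [set: Om] (fun o => inner mu (u t o) g).
  exact: (sol_measurable hu).
have c1 := inner_average_cvg (fun o => sol_Lfun hu o t0) gL phiL mU (mY t) (sol_series hu t0).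
apply/lee_addgt0Pr => e ep.
(* In the nested splitting [X1 + (X2 + X3)] the error of [X1] counts twice and that of [X3] four
   times. *)
have e6 : 0 < e / 6 by rewrite divr_gt0.
have [N1 _ H1] := cvge0_near_le c1 e6; have [N2 _ H2] := cvge0_near_le SZ e6.
pose K := maxn N1 N2.
have {}H1 := H1 K (leq_maxl _ _); have {}H2 := H2 K (leq_maxr _ _).
(* [X1] and [X3] are truncation errors, made small by the choice of [K]. [X2] carries the estimate,
   with a bound that does not depend on [K]. *)
pose X1 o := inner mu (u t o) g - \sum_(k < K) inner mu (phi k) g * Y k t o.
pose X2 o := \sum_(k < K) (inner mu (phi k) g - phi k x) * Y k t o.
pose X3 o := \sum_(k < K) Y k t o * phi k x - Z o.
have mX1 : measurable_fun [set: Om] X1.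
  by apply: measurable_funB => //; apply: (measurable_lincomb K (fun k => inner mu (phi k) g) (mY t)).
have mX2 : measurable_fun [set: Om] X2.
  exact: (measurable_lincomb K (fun k => inner mu (phi k) g - phi k x) (mY t)).
have mX3 : measurable_fun [set: Om] X3.
  apply: measurable_funB => //.
  under eq_fun do under eq_bigr do rewrite mulrC.
  exact: (measurable_lincomb K (phi ^~ x) (mY t)).
have E o : inner mu (u t o) g - Z o = X1 o + (X2 o + X3 o).
  have -> : X2 o = \sum_(k < K) inner mu (phi k) g * Y k t o - \sum_(k < K) Y k t o * phi k x.
    by rewrite -sumrB; apply: eq_bigr => k _; ring.
  by rewrite /X1 /X3; ring.
under eq_integral do rewrite E.
apply: le_trans (sqr_integralD_le P measurableT mX1 (measurable_funD mX2 mX3)) _.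
have H3 : (\int[P]_o (X2 o ^+ 2)%:E <= (A t * (c5 * 2 ^- n))%:E)%E.
  apply: le_trans (msqY t t0 K (fun k => inner mu (phi k) g - phi k x)) _.
  by rewrite lee_fin ler_wpM2l ?(ltW (A0 t))//; exact: osc.
apply: (@le_trans _ _ (2 * (e / 6) + 2 * (2 * (A t * (c5 * 2 ^- n)) + 2 * (e / 6)))%:E).
  rewrite (EFinD (2 * _)) !(EFinM 2) (EFinD (2 * _)) !(EFinM 2).
  apply: leeD; apply: lee_wpmul2l => //.
  apply: le_trans (sqr_integralD_le P measurableT mX2 mX3) _.
  by apply: leeD; apply: lee_wpmul2l.
rewrite -EFinD lee_fin -/gam.
have -> : 8 * c5 / gam * expR (2 * gam * t) * 2 ^- n = 4 * (A t * (c5 * 2 ^- n)).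
  by rewrite /A; move: (expR _) (2 ^- n) => a1 a2; field; rewrite gt_eqF.
lra.
Qed.
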